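(* Let $m,n\ge 0$, $0\le a\le m$, $0\le b\le n$ be integers, let $M=M^{(m)}_a$ and $N=M^{(n)}_b$, and let $L=M\oplus N$ with $L_i=M_i\oplus N_i$ ($i=1,2$). Then $L$ is a graded Dieudonné module with $\dim L_1=m+n+2$ and $\dim(L_1\cap\ker F)=2$, and its Ekedahl–Oort index $\gamma_{u,v}\in\mathbf W(m+n,2)$ is as follows: (A) If $M$ and $N$ are both supersingular (i.e. $a\le m/2$ and $b\le n/2$) and $a\ge b$, then $\gamma_{u,v}=\gamma_{2b+1,2b+2}$ if $a=b$, and $\gamma_{u,v}=\gamma_{2b+2,\,a+b+2}$ if $a>b$. (B) If $M$ and $N$ are both not supersingular (i.e. $a>m/2$ and $b>n/2$) and $m-a\le n-b$, then $\gamma_{u,v}=\gamma_{a+b+1,\,2a+n-m+2}$. (C) If $M$ is not supersingular and $N$ is supersingular (i.e. $a>m/2$ and $b\le n/2$), then $\gamma_{u,v}=\gamma_{\,b+2+\min\{b,\,m-a\},\ a+2+\max\{n-m+a,\,n-b\}}$.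
   Context: Let $k$ be an algebraic closure of $\mathbb F_p$, $p>2$. A (mod $p$) Dieudonné module is a finite-dimensional $k$-vector space $L$ with a Frobenius-semilinear map $F$ ($F(\lambda x)=\lambda^pF(x)$) and a Frobenius$^{-1}$-semilinear map $V$. It is graded if $L=L_1\oplus L_2$ with $F(L_i)\subseteq L_{3-i}$, $V(L_i)\subseteq L_{3-i}$. For a subspace $W$, $V^{-1}(W)=\{x\in L: V(x)\in W\}$. A final filtration of $L$ is a chain $0=W_0\subset W_1\subset\cdots\subset W_{\dim L}=L$ with $\dim W_j=j$ such that for each $j$ both $F(W_j)$ and $V^{-1}(W_j)$ are members of the chain (final filtrations exist). Ekedahl–Oort index: suppose $L$ is graded, $\dim L_1=c+2$, $\dim(L_1\cap\ker F)=2$. For a final filtration $W_\bullet$ of $L$, the subspaces $W_j\cap L_1$ form a chain containing, for each $0\le t\le c+2$, a unique member $E_t$ of dimension $t$. The function $\eta_1(t)=\dim(E_t\cap\ker F)$ is non-decreasing from $0$ to $2$ and increases (by $1$) at exactly two indices $u<v$ (i.e. $\eta_1(u)=\eta_1(u-1)+1$, $\eta_1(v)=\eta_1(v-1)+1$); this is independent of the final filtration. The Ekedahl–Oort index of $L$ is $\gamma_{u,v}=(2,3,\ldots,v)(1,2,\ldots,u)\in\mathfrak S_{c+2}$, an element of $\mathbf W(c,2)=\{\gamma_{u,v}:1\le u<v\le c+2\}$ (permutations composed right to left). (Via Moonen's bijection this identifies the Ekedahl–Oort stratum of the unitary Shimura variety $\mathcal M(c,2)$, $p$ inert in the imaginary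 quadratic field, containing products of points.) The module $M^{(m)}_a$ ($0\le a\le m$): basis $e_{1,j},e_{2,j}$ ($1\le j\le m+1$), $M_i=\mathrm{span}\{e_{i,j}\}$, with $F,V$ the semilinear extensions of: $F(e_{1,j})=e_{2,j}$ if $1\le j\le a$; $=0$ if $j=a+1$; $=e_{2,j-1}$ if $j>a+1$. $V(e_{1,j})=0$ if $j=1$; $=e_{2,j-1}$ if $1<j\le m+1-a$; $=e_{2,j}$ if $j>m+1-a$. $F(e_{2,j})=e_{1,1}$ if $j=m+1-a$, and $0$ otherwise. $V(e_{2,j})=e_{1,a+1}$ if $j=m+1$, and $0$ otherwise. (This is the standard object of the $a$-dimensional Ekedahl–Oort stratum of $\mathcal M(m,1)$.) $M^{(m)}_a$ is called supersingular if $a\le m/2$. *)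

(* Defs.v *)
From HB Require Import structures.
From mathcomp Require Import all_boot all_order all_fingroup all_algebra all_field.
From mathcomp Require Import boolp classical_sets.
Set Implicit Arguments.
Unset Strict Implicit.
Unset Printing Implicit Defensive.
Import GRing.Theory.
Local Open Scope ring_scope.

Definition frob (k : fieldType) (p : nat) (x : k) : k := x ^+ p.

(* The p-th root of x. [xget] selects a solution of y ^+ p = x; see [frobVK]
   and [frobKV] below for the fact that it inverts [frob]. *)
Definition frobV (k : fieldType) (p : nat) (x : k) : k :=
  xget 0 (fun y => y ^+ p = x).

Definition semilinear (k : fieldType) (s : k -> k) (U V : vectType k)
    (f : U -> V) : Prop :=
  forall (c : k) (x y : U), f (c *: x + y) = s c *: f x + f y.

(* The kernel of a semilinear map, as a subspace; see [mem_semiker]. *)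
Definition semiker (k : fieldType) (U V : vectType k) (f : U -> V) :
    {vspace U} :=
  xget 0%VS (fun K : {vspace U} => forall x, x \in K <-> f x = 0).

(* Underlying data of a graded module; the axioms are in [graded_dieudonne]. *)
Record gradedFV (k : fieldType) := GradedFV {
  carrier :> vectType k;
  Fr : carrier -> carrier;
  Ve : carrier -> carrier;
  gr1 : {vspace carrier};
  gr2 : {vspace carrier} }.

Definition dieudonne (k : fieldType) (p : nat) (L : gradedFV k) : Prop :=
  semilinear (@frob k p) (@Fr k L) /\ semilinear (@frobV k p) (@Ve k L).

Definition graded_dieudonne (k : fieldType) (p : nat) (L : gradedFV k) : Prop :=
  [/\ dieudonne p L,
      (gr1 L + gr2 L)%VS = fullv /\ (gr1 L :&: gr2 L)%VS = 0%VS,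
      forall x, x \in gr1 L -> Fr x \in gr2 L /\ Ve x \in gr2 L
    & forall x, x \in gr2 L -> Fr x \in gr1 L /\ Ve x \in gr1 L].

Definition final_filtration (k : fieldType) (L : gradedFV k)
    (W : 'I_(\dim {:L}).+1 -> {vspace L}) : Prop :=
  [/\ W ord0 = 0%VS /\ W ord_max = fullv,
      forall i j : 'I_(\dim {:L}).+1, (i <= j)%N -> (W i <= W j)%VS,
      forall j : 'I_(\dim {:L}).+1, \dim (W j) = j,
      forall j, exists l, forall y,
        y \in W l <-> (exists2 x, x \in W j & Fr x = y)
    & forall j, exists l, forall x, x \in W l <-> Ve x \in W j].

(* E_t: the member of dimension t of the chain of the W_j :&: L_1. *)
Definition gr1_flag (k : fieldType) (L : gradedFV k)
    (W : 'I_(\dim {:L}).+1 -> {vspace L}) (t : nat) : {vspace L} :=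
  if [pick j | \dim (W j :&: gr1 L)%VS == t] is Some j
  then (W j :&: gr1 L)%VS else 0%VS.

Definition eta1 (k : fieldType) (L : gradedFV k)
    (W : 'I_(\dim {:L}).+1 -> {vspace L}) (t : nat) : nat :=
  \dim (gr1_flag W t :&: semiker (@Fr k L))%VS.

(* u and v are exactly the indices in 1..c+2 at which eta1 increases. *)
Definition eta1_jumps (c : nat) (k : fieldType) (L : gradedFV k)
    (W : 'I_(\dim {:L}).+1 -> {vspace L}) (u v : nat) : Prop :=
  [/\ (1 <= u)%N, (u < v)%N, (v <= c.+2)%N
    & forall t : nat, (1 <= t <= c.+2)%N ->
        (eta1 W t = (eta1 W t.-1).+1 <-> t = u \/ t = v)].

Definition cycle_perm (T : finType) (s : seq T) (Us : uniq s) : {perm T} :=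
  perm (can_inj (prev_next Us)).

(* The letters s, s+1, ..., t of {1, ..., n}; the letter i is the element
   i.-1 of 'I_n. *)
Definition letters (n s t : nat) : seq 'I_n :=
  [seq i : 'I_n <- enum 'I_n | (s <= i.+1 <= t)%N].

Lemma letters_uniq n s t : uniq (letters n s t).
Proof. exact/filter_uniq/enum_uniq. Qed.

(* (2,...,v)(1,...,u) composed right to left; the product of permutations in
   MathComp is composed left to right, hence the order of the factors. *)
Definition gamma (c u v : nat) : 'S_c.+2 :=
  (cycle_perm (letters_uniq c.+2 1 u) * cycle_perm (letters_uniq c.+2 2 v))%g.

(* Membership in the set W(c,2). *)
Definition in_Wc2 (c : nat) (g : 'S_c.+2) : Prop :=
  exists u v : nat, [/\ (1 <= u)%N, (u < v)%N, (v <= c.+2)%N & g = gamma c u v].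

(* g is the Ekedahl-Oort index of L: final filtrations exist and each of them
   gives g. *)
Definition EO_index (c : nat) (k : fieldType) (L : gradedFV k) (g : 'S_c.+2) :
    Prop :=
  (exists W : 'I_(\dim {:L}).+1 -> {vspace L}, final_filtration W) /\
  forall W : 'I_(\dim {:L}).+1 -> {vspace L}, final_filtration W ->
    exists u v : nat, eta1_jumps c W u v /\ g = gamma c u v.

(* The basis vector e_{i,j}, for 1 <= i <= 2 and 1 <= j <= m+1. *)
Definition bas (k : fieldType) (m i j : nat) : 'M[k]_(2, m.+1) :=
  \matrix_(r < 2, s < m.+1) ((r.+1 == i) && (s.+1 == j))%:R.

Definition semiext (k : fieldType) (s : k -> k) (m : nat)
    (f : nat -> nat -> 'M[k]_(2, m.+1)) (x : 'M[k]_(2, m.+1)) :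
    'M[k]_(2, m.+1) :=
  \sum_(i < 2) \sum_(j < m.+1) s (x i j) *: f i.+1 j.+1.

Definition F_bas (k : fieldType) (m a i j : nat) : 'M[k]_(2, m.+1) :=
  if i == 1%N then
    if (j <= a)%N then bas k m 2 j
    else if j == a.+1 then 0
    else bas k m 2 j.-1
  else if j == (m.+1 - a)%N then bas k m 1 1 else 0.

Definition V_bas (k : fieldType) (m a i j : nat) : 'M[k]_(2, m.+1) :=
  if i == 1%N then
    if j == 1%N then 0
    else if (j <= m.+1 - a)%N then bas k m 2 j.-1
    else bas k m 2 j
  else if j == m.+1 then bas k m 1 a.+1 else 0.

Definition stdM (k : fieldType) (p m a : nat) : gradedFV k :=
  @GradedFV k 'M[k]_(2, m.+1)
    (semiext (@frob k p) (F_bas k m a))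
    (semiext (@frobV k p) (V_bas k m a))
    <<[seq bas k m 1 j | j <- iota 1 m.+1]>>%VS
    <<[seq bas k m 2 j | j <- iota 1 m.+1]>>%VS.

(* a <= m / 2 *)
Definition supersingular (m a : nat) : bool := (2 * a <= m)%N.

Definition in_left (k : fieldType) (U V : vectType k) (x : U) :
  (U * V)%type := (x, 0).

Definition in_right (k : fieldType) (U V : vectType k) (y : V) :
  (U * V)%type := (0, y).

Lemma in_left_linear (k : fieldType) (U V : vectType k) :
  linear (@in_left k U V).
Proof. by move=> c x y; congr pair; rewrite /= scaler0 addr0. Qed.

Lemma in_right_linear (k : fieldType) (U V : vectType k) :
  linear (@in_right k U V).
Proof. by move=> c x y; congr pair; rewrite /= scaler0 addr0. Qed.

HB.instance Definition _ (k : fieldType) (U V : vectType k) :=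
  GRing.isLinear.Build k U (U * V)%type _ _ (@in_left_linear k U V).

HB.instance Definition _ (k : fieldType) (U V : vectType k) :=
  GRing.isLinear.Build k V (U * V)%type _ _ (@in_right_linear k U V).

Definition subspace_sum (k : fieldType) (U V : vectType k)
    (A : {vspace U}) (B : {vspace V}) : {vspace (U * V)%type} :=
  (linfun (@in_left k U V) @: A + linfun (@in_right k U V) @: B)%VS.

Lemma mem_subspace_sum (k : fieldType) (U V : vectType k)
    (A : {vspace U}) (B : {vspace V}) (z : U * V) :
  (z \in subspace_sum A B) = (z.1 \in A) && (z.2 \in B).
Proof.
apply/memv_addP/andP.
  move=> [_ /memv_imgP[x xA ->] [_ /memv_imgP[y yB ->] ->]].
  by rewrite !lfunE /= addr0 add0r.
move=> [zA zB]; exists (in_left V z.1).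
  by rewrite -(lfunE (@in_left k U V)) memv_img.
exists (in_right U z.2).
  by rewrite -(lfunE (@in_right k U V)) memv_img.
by case: z {zA zB} => x y; congr pair; rewrite /= ?addr0 ?add0r.
Qed.

Definition dsum (k : fieldType) (M N : gradedFV k) : gradedFV k :=
  @GradedFV k (M * N)%type
    (fun z => (Fr z.1, Fr z.2))
    (fun z => (Ve z.1, Ve z.2))
    (subspace_sum (gr1 M) (gr1 N))
    (subspace_sum (gr2 M) (gr2 N)).

Lemma frobVK (k : closedFieldType) (p : nat) (x : k) :
  (0 < p)%N -> frob p (frobV p x) = x.
Proof.
move=> p0; rewrite /frob /frobV.
apply: (@xgetPex k 0 (fun y : k => y ^+ p = x)).
have [y hy] := @solve_monicpoly k p (fun i => if i == 0%N then x else 0) p0.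
exists y; rewrite hy; case: p p0 {hy} => // p _.
by rewrite big_ord_recl big1 ?addr0 ?expr0 ?mulr1 // => i _; rewrite mul0r.
Qed.

Lemma frobKV (k : closedFieldType) (p : nat) (x : k) :
  p \in [pchar k] -> frobV p (frob p x) = x.
Proof.
move=> chp; have p0 : (0 < p)%N by rewrite prime_gt0 ?(pcharf_prime chp).
have := frobVK (frob p x) p0; rewrite /frob.
rewrite -!(pFrobenius_autE chp); exact: fmorph_inj.
Qed.

Lemma mem_semiker (k : fieldType) (s : k -> k) (U V : vectType k)
    (f : U -> V) (x : U) :
  s 1 = 1 -> semilinear s f -> (x \in semiker f) <-> f x = 0.
Proof.
move=> s1 fL; rewrite /semiker.
suff /(@xgetPex _ 0%VS) : exists K : {vspace U}, forall x, x \in K <-> f x = 0 by apply.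
have f0 : f 0 = 0.
  have := fL 1 0 0; rewrite scaler0 addr0 s1 scale1r => /esym/eqP.
  by rewrite -subr_eq0 addrK => /eqP.
pose P n := `[< exists2 K : {vspace U}, \dim K = n & forall x, x \in K -> f x = 0 >].
have exP : exists n, P n.
  exists 0%N; apply/asboolP; exists 0%VS; first exact: dimv0.
  by move=> y; rewrite memv0 => /eqP ->.
have ubP n : P n -> (n <= \dim {:U})%N.
  by move/asboolP => [K <- _]; rewrite dimvS ?subvf.
case: (ex_maxnP exP ubP) => n /asboolP [K dK hK] nmax.
exists K => y; split; first exact: hK.
move=> fy; apply: contraT => yK.
have : P (\dim (K + <[y]>)%VS).
  apply/asboolP; exists (K + <[y]>)%VS => // z /memv_addP [w wK [v]].
  by move=> /vlineP [c ->] ->; rewrite addrC fL fy scaler0 add0r hK.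
move/nmax; rewrite -dK => le; case/negP: yK; rewrite memvE.
have /eqP -> : K == (K + <[y]>)%VS by rewrite eqEdim addvSl.
exact: addvSr.
Qed.

(* Main.v *)
(* Both modules have a basis on which F, or V^-1 on the kernel of F = image of V,
   acts as a permutation pi.  Attach to a basis vector its backward itinerary,
   the periodic word recording at each step back along pi whether the vector is
   an F-image (letter F) or is reached through V^-1 (letter V), and order the
   words lexicographically with F < V.

   Starting from 0 and L, the operations F and V^-1 produce every span of an
   initial segment for this order, so all of these belong to every final
   filtration.  Vectors with the same itinerary are either all killed by F or
   none is, hence the two jumps of eta_1 are the ranks, among the basis vectors
   of L_1, of the two that F kills: e_{1,a+1} of M and e_{1,b+1} of N.

   A final filtration exists because the order refines to a total order
   compatible with pi as soon as no two vectors of one orbit have the same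
   itinerary.  This fails for the given basis only when 0 < m = a, and then
   e_{1,j} + e_{2,j} and e_{1,j} - e_{2,j}, for j = 1 and j = m+1, repair it.

   For the ranks: with r = min(a, m-a), the vector e_{1,s+1} has itinerary
   (VF)^s F... for s <= r, (VF)^(m-s) VV... for s near m, and (VF)^oo between. *)
From mathcomp Require Import all_boot all_order all_fingroup all_algebra all_field.
From mathcomp Require Import zify ring.
Require Import Defs.
Set Implicit Arguments.
Unset Strict Implicit.
Unset Printing Implicit Defensive.
Import GRing.Theory.

(** * Backward itineraries *)

Section Itineraries.
Variables (X : finType) (pi be : X -> X) (tau : pred X).
Hypotheses (piK : cancel pi be) (beK : cancel be pi).

Definition word (x : X) (t : nat) : bool := ~~ tau (iter t.+1 be x).

(** The first [n] letters read as a binary number with V = 1, the first letter being the most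
    significant, so that comparing numbers compares words lexicographically. *)
Fixpoint wval (n : nat) (x : X) : nat :=
  if n is n'.+1 then ~~ tau (be x) * 2 ^ n' + wval n' (be x) else 0.

Lemma wval_lt n x : wval n x < 2 ^ n.
Proof.
elim: n x => [//|n IH] x /=; rewrite expnS; have := IH (be x).
by case: (tau _) => /=; lia.
Qed.

Lemma wval_last n x : wval n.+1 x = 2 * wval n x + ~~ tau (iter n.+1 be x).
Proof.
elim: n x => [|n IH] x; first by rewrite /= muln1 muln0 addn0.
rewrite -[LHS]/(~~ tau (be x) * 2 ^ n.+1 + wval n.+1 (be x)) IH /= expnS.
by rewrite -!iterS !iterSr /=; lia.
Qed.

Lemma wval_pi n x : wval n.+1 (pi x) = ~~ tau x * 2 ^ n + wval n x.
Proof. by rewrite /= piK. Qed.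

Lemma wordS x t : word x t.+1 = word (be x) t.
Proof. by rewrite /word iterSr. Qed.

Lemma eq_wval n x y : word x =1 word y -> wval n x = wval n y.
Proof.
elim: n x y => [//|n IH] x y e /=; have := e 0; rewrite /word /= => ->.
by congr (_ + _); apply: IH => t; rewrite -!wordS.
Qed.

Definition period : nat := #[perm (can_inj beK)]%g.-1.

Lemma iter_period x : iter period.+1 be x = x.
Proof.
have qe n y : iter n be y = ((perm (can_inj beK)) ^+ n)%g y.
  by rewrite permX; elim: n y => //= n IH y; rewrite IH permE.
by rewrite qe prednK ?order_gt0 // expg_order perm1.
Qed.

(* Backward itineraries are periodic, so the last of these [period.+1] letters
   is the type of [x] itself. *)
Definition itinerary (x : X) : nat := wval period.+1 x.

Lemma itinE x : itinerary x = 2 * wval period x + ~~ tau x.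
Proof. by rewrite /itinerary wval_last iter_period. Qed.

(** Applying [pi] moves the last letter of the periodic word to the front. With [itinE] this turns
    comparisons of [pi x] and [pi y] into comparisons of [x] and [y]. *)
Lemma itin_pi x : itinerary (pi x) = ~~ tau x * 2 ^ period + wval period x.
Proof. exact: wval_pi. Qed.

Lemma itin_lt_pi x y : tau x -> ~~ tau y -> itinerary (pi x) < itinerary (pi y).
Proof.
move=> tx ty; rewrite !itin_pi tx ty /=; have := wval_lt period x; lia.
Qed.

Lemma itin_pi_mono x y : tau x = tau y ->
  (itinerary (pi x) < itinerary (pi y)) = (itinerary x < itinerary y).
Proof. by move=> e; rewrite !itin_pi !itinE e; lia. Qed.

Lemma itin_inj_tau x y : itinerary x = itinerary y -> tau x = tau y.
Proof. by rewrite !itinE; case: (tau x) (tau y) => [] [] /=; lia. Qed.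

(** The front letter outweighs all the others together, so equal itineraries agree in that letter
    and in the remaining number. *)
Lemma itin_be x y : itinerary x = itinerary y -> itinerary (be x) = itinerary (be y).
Proof.
rewrite -{1}(beK x) -{1}(beK y) !itin_pi !itinE.
have := wval_lt period (be x); have := wval_lt period (be y).
by case: (tau (be x)) (tau (be y)) => [] [] /=; lia.
Qed.

Lemma itin_word x y : itinerary x = itinerary y -> word x =1 word y.
Proof.
move=> e t; elim: t x y e => [|t IH] x y e.
  by rewrite /word /= (itin_inj_tau (itin_be e)).
by rewrite !wordS; apply/IH/itin_be.
Qed.

Definition lexlt (f g : nat -> bool) : Prop :=
  exists t, [/\ forall i, i < t -> f i = g i, f t = false & g t].

(** Induction on the place of the first disagreement: [be] strips a common first letter without
    changing the comparison, and [itin_lt_pi] settles different first letters. *)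
Lemma itin_lex x y : lexlt (word x) (word y) -> itinerary x < itinerary y.
Proof.
move=> [t]; elim: t x y => [|t IH] x y [eqt ft gt].
  move: ft gt; rewrite /word /= => /negbFE tx ty.
  by rewrite -(beK x) -(beK y) itin_lt_pi.
have := eqt 0 isT; rewrite /word /= => /negb_inj e0.
rewrite -(beK x) -(beK y) itin_pi_mono //; apply: IH.
rewrite -!wordS; split=> // i lti; rewrite -!wordS; exact: eqt.
Qed.

End Itineraries.

(** * Initial segments of a total order on the basis *)

Section Order.
Variables (X : finType) (key : X -> nat).
Hypothesis key_inj : injective key.

Definition krank (x : X) : nat := #|[set y | key y < key x]|.

Lemma krank_mono x y : (krank x < krank y) = (key x < key y).
Proof.
have mono u w : key u < key w -> krank u < krank w.
  move=> lt; apply: proper_card; apply/properP; split.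
    by apply/fintype.subsetP => z; rewrite !inE => /ltn_trans; apply.
  by exists u; rewrite !inE ?ltnn.
apply/idP/idP; last exact: mono.
move=> lt; rewrite ltnNge leq_eqVlt; apply/negP => /orP[/eqP/key_inj e|/mono].
  by rewrite e ltnn in lt.
by rewrite ltnNge ltnW.
Qed.

Lemma krank_lt x : krank x < #|X|.
Proof.
rewrite -cardsT; apply: proper_card; apply/properP; split.
  exact/fintype.subsetP.
by exists x; rewrite !inE ?ltnn.
Qed.

Lemma krank_inj : injective krank.
Proof.
move=> x y e; apply: key_inj; have := krank_mono x y; have := krank_mono y x.
by rewrite e ltnn; lia.
Qed.

Definition kseg (j : nat) : {set X} := [set x | krank x < j].

Lemma card_kseg j : j <= #|X| -> #|kseg j| = j.
Proof.
move=> lej; pose f (x : X) := Ordinal (krank_lt x).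
have finj : injective f by move=> x y /(congr1 val)/krank_inj.
have -> : kseg j = f @^-1: [set i | val i < j].
  by apply/setP => x; rewrite !inE.
have fbij : bijective f by apply: inj_card_bij; rewrite ?card_ord.
rewrite on_card_preimset; last exact: onW_bij.
case: j lej => [|j] lej.
  by apply/eqP; rewrite cards_eq0; apply/eqP/setP => x; rewrite !inE.
have -> : [set i : 'I_#|X| | val i < j.+1] = [set widen_ord lej i | i : 'I_j.+1].
  apply/setP => i; rewrite inE; apply/idP/imsetP => [lt|[z _ ->]]; last by case: z.
  by exists (Ordinal lt) => //; apply: val_inj.
by rewrite card_imset ?card_ord // => x y /(congr1 val) /= /val_inj.
Qed.

(** An element of the down-set outside the segment of the same size outranks that whole segment,
    which then lies in the down-set. So one set contains the other, and equal sizes give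
    equality. *)
Lemma downset_kseg (S : {set X}) :
  (forall x y, key x < key y -> y \in S -> x \in S) -> S = kseg #|S|.
Proof.
move=> dS; have le := max_card S; have c := card_kseg le.
have [sub|/subsetPn[x xS nx]] := boolP (S \subset kseg #|S|).
  by apply/eqP; rewrite eqEcard sub c leqnn.
apply/esym/eqP; rewrite eqEcard c leqnn andbT.
apply/fintype.subsetP => y; rewrite !inE => lty; apply: (dS _ x) => //.
by rewrite -krank_mono (leq_trans lty) //; move: nx; rewrite inE -leqNgt.
Qed.

End Order.

(** * Monomial bases *)

Local Open Scope ring_scope.

(* F maps [e_x] into the line of [e_(pi x)] when [tau x] holds, and kills it
   otherwise; in the latter case V maps [e_(pi x)] to a multiple of [e_x]. *)
Record monomial (k : fieldType) (p : nat) (L : gradedFV k) := Monomial {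
  idx : finType;
  ebas : idx -> L;
  coord : idx -> L -> k;
  pi : idx -> idx;
  be : idx -> idx;
  tau : pred idx;
  cF : idx -> k;
  cV : idx -> k;
  piK : cancel pi be;
  beK : cancel be pi;
  coordP : forall x c z w, coord x (c *: z + w) = c * coord x z + coord x w;
  coord_bas : forall x y, coord x (ebas y) = (x == y)%:R;
  coordE : forall z, z = \sum_x coord x z *: ebas x;
  cF_neq0 : forall x, cF x != 0;
  cV_neq0 : forall x, cV x != 0;
  coord_Fr : forall x z,
    coord (pi x) (Fr z) = if tau x then frob p (coord x z) * cF x else 0;
  coord_Ve : forall x z,
    coord x (Ve z) = if tau x then 0 else frobV p (coord (pi x) z) * cV x }.

Section Monomial.
Variables (k : closedFieldType) (p : nat) (p_gt0 : (0 < p)%N).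
Variables (L : gradedFV k) (B : monomial p L).

Local Notation X := (idx B).
Local Notation e := (@ebas k p L B).
Local Notation co := (@coord k p L B).
Local Notation pi := (@pi k p L B).
Local Notation be := (@be k p L B).
Local Notation tau := (@tau k p L B).
Local Notation itin := (itinerary tau (@beK k p L B)).

Lemma coord0 x : co x 0 = 0.
Proof.
have := coordP x (-1) 0 0; rewrite scaler0 addr0 => ->.
by rewrite mulN1r addNr.
Qed.

Lemma coordZ x c z : co x (c *: z) = c * co x z.
Proof. by rewrite -[c *: z]addr0 coordP coord0 addr0. Qed.

Lemma coordD x z w : co x (z + w) = co x z + co x w.
Proof. by rewrite -[z in LHS]scale1r coordP mul1r. Qed.

Lemma coord_sum x (I : Type) (r : seq I) (P : pred I) (f : I -> L) :
  co x (\sum_(i <- r | P i) f i) = \sum_(i <- r | P i) co x (f i).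
Proof.
apply: (big_morph (co x)); [exact: coordD | exact: coord0].
Qed.

Lemma coord_inj z w : (forall x, co x z = co x w) -> z = w.
Proof.
by move=> h; rewrite (coordE B z) (coordE B w); apply: eq_bigr => x _; rewrite h.
Qed.

Lemma coord_comb (c : X -> k) x : co x (\sum_y c y *: e y) = c x.
Proof.
rewrite coord_sum (bigD1 x) //= big1 => [|y nyx].
  by rewrite coordZ coord_bas eqxx mulr1 addr0.
by rewrite coordZ coord_bas eq_sym (negPf nyx) mulr0.
Qed.

Definition bspan (S : {set X}) : {vspace L} := (\sum_(x in S) <[e x]>)%VS.

Lemma mem_bspan (S : {set X}) z : z \in bspan S <-> forall x, x \notin S -> co x z = 0.
Proof.
split=> [/memv_sumP [f fS ->] x xS|h].
  rewrite coord_sum big1 // => i iS; case/vlineP: (fS i iS) => c ->.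
  rewrite coordZ coord_bas; case: eqP xS => [-> |]; last by rewrite mulr0.
  by rewrite iS.
rewrite (coordE B z); apply: memv_suml => x _.
have [xS|/h ->] := boolP (x \in S); last by rewrite scale0r mem0v.
by apply: memvZ; rewrite memvE; exact: (sumv_sup x).
Qed.

Lemma eq_bspan (S : {set X}) (W : {vspace L}) :
  (forall z, z \in W <-> forall x, x \notin S -> co x z = 0) -> W = bspan S.
Proof.
by move=> h; apply/vspaceP => z; apply/idP/idP => [/h/mem_bspan|/mem_bspan/h].
Qed.

Lemma dim_bspan S : \dim (bspan S) = #|S|.
Proof.
have dir : directv (\sum_(x in S) <[e x]>)%VS.
  apply/directv_sum_independent => f fS s0 i iS.
  have fE x : x \in S -> f x = co x (f x) *: e x.
    move=> /fS /vlineP [c ->].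
    by rewrite coordZ coord_bas eqxx mulr1.
  have := congr1 (co i) s0; rewrite coord_sum coord0 (bigD1 i) //= big1.
    by rewrite addr0 => ci; rewrite (fE i iS) ci scale0r.
  move=> x /andP[xS nxi]; rewrite (fE x xS) coordZ coord_bas eq_sym (negPf nxi).
  by rewrite mulr0.
rewrite /bspan (directvP dir) /= -sum1_card; apply: eq_bigr => x _.
rewrite dim_vline; case: eqP => // e0; have := coord_bas (x : X) x.
by rewrite e0 coord0 eqxx => /esym/eqP; rewrite oner_eq0.
Qed.

Lemma bspan_capI S T : (bspan S :&: bspan T)%VS = bspan (S :&: T).
Proof.
apply: eq_bspan => z; rewrite memv_cap; split.
  by move=> /andP[/mem_bspan zS /mem_bspan zT] x; rewrite inE negb_and => /orP[/zS|/zT].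
by move=> h; apply/andP; split; apply/mem_bspan => x nx; apply: h;
  rewrite inE negb_and nx ?orbT.
Qed.

Lemma bspan_setT : bspan setT = fullv.
Proof.
by apply/esym/eq_bspan => z; split=> [_ x|_]; rewrite ?memvf // in_setT.
Qed.

Lemma bspan_set0 : bspan set0 = 0%VS.
Proof. by rewrite /bspan big_set0. Qed.

Lemma bspan_subset (S T : {set X}) : S \subset T -> (bspan S <= bspan T)%VS.
Proof.
move/fintype.subsetP => sST; apply/subvP => z /mem_bspan h; apply/mem_bspan => x nx.
by apply: h; apply: contra nx; exact: sST.
Qed.

Lemma dim_mono : \dim {:L} = #|X|.
Proof. by rewrite -bspan_setT dim_bspan cardsT. Qed.

Lemma frobV0 : frobV p (0 : k) = 0.
Proof.
have := frobVK (0 : k) p_gt0; rewrite /frob => /eqP.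
by rewrite expf_eq0 p_gt0 => /eqP.
Qed.

Lemma frobV_eq0 (x : k) : frobV p x = 0 -> x = 0.
Proof. by move=> h; rewrite -(frobVK x p_gt0) h /frob expr0n gtn_eqF. Qed.

Lemma frob0 : frob p (0 : k) = 0.
Proof. by rewrite /frob expr0n gtn_eqF. Qed.

Lemma frob_eq0 (x : k) : frob p x = 0 -> x = 0.
Proof. by move/eqP; rewrite /frob expf_eq0 p_gt0 => /eqP. Qed.

Lemma Fr_bspan (S : {set X}) y :
  y \in bspan (pi @: [set x in S | tau x]) <-> exists2 z, z \in bspan S & Fr z = y.
Proof.
have piI := can_inj (piK (m := B)).
split=> [/mem_bspan h|[z /mem_bspan zS <-]].
  (* A preimage is built coordinate by coordinate: divide by the constant of F and take the p-th
     root. *)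
  exists (\sum_x (if (x \in S) && tau x then frobV p (co (pi x) y / cF x) else 0)
            *: e x).
    by apply/mem_bspan => x nx; rewrite coord_comb (negPf nx).
  apply: coord_inj => x; rewrite -(beK x) coord_Fr coord_comb; set x' := be x.
  have [tx|ntx] := boolP (tau x'); last first.
    rewrite h //; apply: contra ntx => /imsetP [w]; rewrite !inE => /andP[_ tw].
    by move/piI => ->.
  have [xS|nxS] /= := boolP (x' \in S).
    by rewrite frobVK // mulfVK ?cF_neq0.
  rewrite frob0 mul0r h //; apply: contra nxS => /imsetP [w].
  by rewrite !inE => /andP[wS _] /piI ->.
apply/mem_bspan => x nx; rewrite -(beK x) coord_Fr; case: ifP => // tx.
rewrite zS ?frob0 ?mul0r //; apply: contra nx => xS.
by apply/imsetP; exists (be x); rewrite ?beK // !inE xS.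
Qed.

(** V kills the basis vector of index [pi x] exactly when [tau x] holds, so the preimage of any span
    contains all of these vectors. *)
Lemma Ve_bspan (S : {set X}) z :
  z \in bspan (pi @: [set x | tau x || (x \in S)]) <-> Ve z \in bspan S.
Proof.
have piI := can_inj (piK (m := B)).
split=> [/mem_bspan h|/mem_bspan h]; apply/mem_bspan => x nx.
  rewrite coord_Ve; case: ifP => // tx; rewrite h ?frobV0 ?mul0r //.
  by apply: contra nx => /imsetP [w]; rewrite inE => + /piI e; rewrite -e tx.
have /norP[ntx nxS] : ~~ (tau (be x) || (be x \in S)).
  by apply: contra nx => h'; apply/imsetP; exists (be x); rewrite ?beK ?inE.
have := h _ nxS; rewrite coord_Ve (negPf ntx) beK => /eqP.
by rewrite mulf_eq0 (negPf (cV_neq0 _)) orbF => /eqP/frobV_eq0.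
Qed.

End Monomial.

(** * Existence of final filtrations *)

Section Existence.
Variables (k : closedFieldType) (p : nat) (p_gt0 : (0 < p)%N).
Variables (L : gradedFV k) (B : monomial p L).

Local Notation X := (idx B).
Local Notation pi := (@pi k p L B).
Local Notation be := (@be k p L B).
Local Notation tau := (@tau k p L B).
Local Notation itin := (itinerary tau (@beK k p L B)).

Definition primitive : Prop := forall (x : X) n,
  word be tau (iter n pi x) =1 word be tau x -> iter n pi x = x.

Hypothesis prim : primitive.

Let piI : injective pi := can_inj (@piK k p L B).
(** An orbit of [pi] is numbered by its rank among all subsets of [X]. The number of subsets exceeds
    every such rank, so [key] orders by itinerary first and breaks ties by orbit. *)
Let lab (x : X) : nat := enum_rank [set y | fconnect pi x y].
Let key (x : X) : nat := (itin x * #|{set X}| + lab x)%N.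

Let lab_lt x : (lab x < #|{set X}|)%N.
Proof. exact: ltn_ord. Qed.

Let lab_pi x : lab (pi x) = lab x.
Proof.
rewrite /lab; suff -> : [set y | fconnect pi (pi x) y] = [set y | fconnect pi x y].
  by [].
by apply/setP => y; rewrite !inE -(same_fconnect1 piI).
Qed.

Let key_ltE x y :
  (key x < key y)%N = (itin x < itin y)%N || (itin x == itin y) && (lab x < lab y)%N.
Proof.
rewrite /key; have := lab_lt x; have := lab_lt y.
by case: (ltngtP (itin x) (itin y)) => [lt|lt|->] /=; [nia|nia|lia].
Qed.

(** Equal keys mean equal words within one orbit, and primitivity excludes this for distinct
    vectors. *)
Let key_inj : injective key.
Proof.
move=> x y e.
have [ei el] : itin x = itin y /\ lab x = lab y.
  have := lab_lt x; have := lab_lt y; move: e; rewrite /key.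
  by case: (ltngtP (itin x) (itin y)) => [lt|lt|->]; [nia|nia|lia].
have : y \in [set z | fconnect pi x z].
  by move/val_inj/enum_rank_inj: el => ->; rewrite inE connect0.
rewrite inE => /iter_findex ey; rewrite -ey; apply/esym/prim; rewrite ey.
exact: itin_word (@piK k p L B) _ _ _ (esym ei).
Qed.

Let key_pi_lt x y : tau x -> ~~ tau y -> (key (pi x) < key (pi y))%N.
Proof. by move=> tx ty; rewrite key_ltE (itin_lt_pi (@piK k p L B)). Qed.

Let key_pi x y : tau x = tau y -> (key (pi x) < key (pi y))%N = (key x < key y)%N.
Proof.
move=> e; have mono := itin_pi_mono (@piK k p L B) (@beK k p L B).
rewrite !key_ltE !lab_pi !eqn_leq !(leqNgt (itin _)).
by rewrite (mono _ _ _ e) (mono _ _ _ (esym e)).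
Qed.

Lemma final_filtration_exists :
  exists W : 'I_(\dim {:L}).+1 -> {vspace L}, final_filtration W.
Proof.
pose W (j : 'I_(\dim {:L}).+1) := bspan (B := B) (kseg key j); exists W.
have le_card (S : {set X}) : (#|S| < (\dim {:L}).+1)%N.
  by rewrite ltnS (dim_mono B) max_card.
have down (S : {set X}) : (forall x y, (key x < key y)%N -> y \in S -> x \in S) ->
    bspan S = W (Ordinal (le_card S)).
  by move=> h; rewrite /W /= -downset_kseg.
have seg_down j x y : (key x < key y)%N -> y \in kseg key j -> x \in kseg key j.
  by rewrite !inE -krank_mono // => /ltn_trans; apply.
split.
- split; first by rewrite /W -(bspan_set0 B); congr bspan; apply/setP => x; rewrite !inE.
  apply: (etrans _ (bspan_setT B)); rewrite /W /= (dim_mono B); congr bspan.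
  by apply/setP => x; rewrite !inE krank_lt.
- move=> i j le; apply: bspan_subset; apply/fintype.subsetP => x.
  by rewrite !inE => /leq_trans; apply.
- by move=> j; rewrite dim_bspan card_kseg // -(dim_mono B) -ltnS.
(* The F-image of a segment is a down-set: images under [pi] of vectors with [tau] precede all other
   vectors, and [pi] preserves the order among them. *)
- move=> j; set S := pi @: [set x in kseg key j | tau x].
  exists (Ordinal (le_card S)) => y; rewrite -down; first exact: Fr_bspan.
  move=> x y' /[swap] /imsetP [w]; rewrite inE => /andP[wS tw] -> lt.
  have tx : tau (be x).
    apply: contraT => ntx; move: lt; rewrite -(beK x) ltnNge ltnW //.
    exact: key_pi_lt.
  apply/imsetP; exists (be x); rewrite ?beK // inE tx andbT.
  by apply: seg_down wS; rewrite -key_pi ?beK // tx tw.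
(* The preimage under V consists of all images of vectors with [tau], which come first, and of the
   images of an initial part of the others. *)
move=> j; set S := pi @: [set x | tau x || (x \in kseg key j)].
exists (Ordinal (le_card S)) => y; rewrite -down; first exact: Ve_bspan.
move=> x y' /[swap] /imsetP [w]; rewrite inE => wS -> lt.
apply/imsetP; exists (be x); rewrite ?beK // inE; have [//|ntx /=] := boolP (tau (be x)).
have [tw|ntw] := boolP (tau w).
  by have := ltn_trans lt (key_pi_lt tw ntx); rewrite beK ltnn.
move: wS; rewrite (negPf ntw) /= => wS.
by apply: seg_down wS; rewrite -key_pi ?beK // (negPf ntx) (negPf ntw).
Qed.

End Existence.

(** * The jumps of eta_1 *)

(** Unit steps make [f] monotone, so the values next to the two jumps force it to be constant on the
    three intervals between. *)
Lemma unit_step_jumps (f : nat -> nat) (c A C : nat) :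
  (forall t, t < c -> f t <= f t.+1 <= (f t).+1)%N ->
  (A.+1 < C <= c)%N -> f A = 0%N -> f A.+1 = 1%N -> f C.-1 = 1%N -> f C = 2%N ->
  f c = 2%N ->
  forall t, (1 <= t <= c)%N -> (f t = (f t.-1).+1 <-> t = A.+1 \/ t = C).
Proof.
move=> step AC fA fA1 fC1 fC fc.
have mono s t : (s <= t)%N -> (t <= c)%N -> (f s <= f t)%N.
  elim: t => [|t IH]; first by rewrite leqn0 => /eqP ->.
  rewrite leq_eqVlt => /orP[/eqP -> //|]; rewrite ltnS => st tc.
  by have := IH st (ltnW tc); have := step t tc; lia.
case=> [//|t] /= tc; split=> [ft|[[->]|e]]; first last.
- by rewrite -e /= in fC1; rewrite e fC fC1.
- by rewrite fA fA1.
have [tA|At] := ltnP t A.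
  by have := mono t.+1 A tA ltac:(lia); lia.
have [->|nA] := eqVneq t A; first by left.
have [->|nC] := eqVneq t.+1 C; first by right.
have [tC|Ct] := ltnP t.+1 C.
  have := mono A.+1 t ltac:(lia) ltac:(lia).
  by have := mono t.+1 C.-1 ltac:(lia) ltac:(lia); lia.
have := mono C t ltac:(lia) ltac:(lia).
by have := mono t.+1 c ltac:(lia) ltac:(lia); lia.
Qed.

(** The quotient of [U' :&: A] by [U :&: A] embeds in the quotient of [U'] by [U]. *)
Lemma dim_cap_step (k : fieldType) (V : vectType k) (U U' A : {vspace V}) :
  (U <= U')%VS -> (\dim (U' :&: A) + \dim U <= \dim (U :&: A) + \dim U')%N.
Proof.
move=> sU; have := dimv_sum_cap U (U' :&: A)%VS.
have : (U + U' :&: A <= U')%VS by rewrite subv_add sU capvSl.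
have : (U :&: (U' :&: A) <= U :&: A)%VS by rewrite capvS // capvSr.
by move/dimvS => + /dimvS; lia.
Qed.

Section Jumps.
Variables (k : closedFieldType) (p : nat) (p_gt0 : (0 < p)%N).
Variables (L : gradedFV k) (B : monomial p L).

Local Notation X := (idx B).
Local Notation pi := (@pi k p L B).
Local Notation be := (@be k p L B).
Local Notation tau := (@tau k p L B).
Local Notation itin := (itinerary tau (@beK k p L B)).

Hypothesis Fr_semi : semilinear (@frob k p) (@Fr k L).

Lemma semiker_bspan : semiker (@Fr k L) = bspan (B := B) [set x | ~~ tau x].
Proof.
apply: eq_bspan => z.
rewrite (mem_semiker z (s := @frob k p)) ?/frob ?expr1n //; split=> [Fz x|h].
  rewrite inE negbK => tx; have := coord_Fr x z; rewrite Fz coord0 tx.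
  by move/esym/eqP; rewrite mulf_eq0 (negPf (cF_neq0 _)) orbF => /eqP/(frob_eq0 p_gt0).
apply: (coord_inj (B := B)) => x; rewrite coord0 -(beK x) coord_Fr.
case: ifP => // tx; rewrite h ?inE ?tx //.
by rewrite (frob0 _ p_gt0) mul0r.
Qed.

Variable gr : {set X}.
Hypothesis gr1E : gr1 L = bspan (B := B) gr.

Section Filtration.
Variables (W : 'I_(\dim {:L}).+1 -> {vspace L}) (Wf : final_filtration W).

(** Induction on the number of letters. A threshold up to [2 ^ n] selects only words beginning with
    F, and they form the F-image of a shorter segment. A larger one takes all those words and, among
    the words beginning with V, the segment of threshold [th - 2 ^ n], which is what V^-1
    produces. *)
Lemma canonical_member n th :
  exists j, W j = bspan (B := B) [set x | wval be tau n x < th]%N.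
Proof.
have [[W0 W1] _ _ WF WV] := Wf.
elim: n th => [|n IH] th.
  (* With no letter read every value is 0: threshold 0 gives the zero space and any other gives
     [L]. *)
  case: th => [|th]; [exists ord0|exists ord_max].
    by rewrite W0 -(bspan_set0 B); congr bspan; apply/setP => x; rewrite !inE.
  by rewrite W1 -(bspan_setT B); congr bspan; apply/setP => x; rewrite !inE.
have lt x : (wval be tau n x < 2 ^ n)%N := wval_lt be tau n x.
have [le|gt] := leqP th (2 ^ n).
  have [j Wj] := IH th; have [l Wl] := WF j; exists l.
  have -> : [set x | wval be tau n.+1 x < th]%N
          = pi @: [set x in [set x | wval be tau n x < th]%N | tau x].
    apply/setP => x; rewrite inE; apply/idP/imsetP => [|[z]]; rewrite ?inE.
      rewrite -{1}(beK x) (wval_pi _ (@piK k p L B)) => h; exists (be x); rewrite ?beK //.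
      by rewrite !inE; case: (tau _) h => /=; lia.
    by move=> /andP[h tz] ->; rewrite (wval_pi _ (@piK k p L B)) tz.
  by apply/vspaceP => y; apply/idP/idP => [/Wl|/(Fr_bspan p_gt0)];
    [rewrite Wj => /(Fr_bspan p_gt0)|rewrite -Wj => /Wl].
have [j Wj] := IH (th - 2 ^ n)%N; have [l Wl] := WV j; exists l.
have -> : [set x | wval be tau n.+1 x < th]%N
    = pi @: [set x | tau x || (x \in [set x | wval be tau n x < th - 2 ^ n]%N)].
  apply/setP => x; rewrite inE; apply/idP/imsetP => [|[z]]; rewrite ?inE.
    rewrite -{1}(beK x) (wval_pi _ (@piK k p L B)) => h; exists (be x); rewrite ?beK //.
    by rewrite !inE; case: (tau _) h => //=; lia.
  move=> /orP h ->; rewrite (wval_pi _ (@piK k p L B)).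
  by have := lt z; case: (tau z) h => /= -[]; lia.
by apply/vspaceP => y; apply/idP/idP => [/Wl|/(Ve_bspan p_gt0)];
  [rewrite Wj => /(Ve_bspan p_gt0)|rewrite -Wj => /Wl].
Qed.

Local Notation D j := (W j :&: gr1 L)%VS.

Lemma gr1_chain i j : (\dim (D i) <= \dim (D j))%N -> (D i <= D j)%VS.
Proof.
have [_ Wle _ _ _] := Wf => le.
have [ij|/ltnW ji] := leqP i j; first by rewrite capvS // Wle.
have sub : (D j <= D i)%VS by rewrite capvS // Wle.
have /eqP -> // : D j == D i by rewrite eqEdim sub.
Qed.

(** The dimensions of the [D j] climb from 0 to [#|gr|] by steps of at most 1, so the least index
    reaching [t] attains it exactly, and the default value of [gr1_flag] does not occur. *)
Lemma gr1_flagP t : (t <= #|gr|)%N ->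
  exists j, gr1_flag W t = D j /\ \dim (D j) = t.
Proof.
move=> le; have [[W0 W1] Wle Wdim _ _] := Wf.
rewrite /gr1_flag; case: pickP => [j /eqP dj|none]; first by exists j.
pose d (i : nat) := \dim (D (inord i)).
have exd : exists i, (i <= \dim {:L})%N && (t <= d i)%N.
  exists (\dim {:L}); rewrite leqnn /d.
  have -> : inord (\dim {:L}) = ord_max :> 'I_(\dim {:L}).+1.
    by apply: val_inj; rewrite /= inordK.
  by rewrite W1 capfv gr1E dim_bspan.
case: (ex_minnP exd) => i /andP[iN ti] imin.
have /eqP[] := none (inord i); apply/eqP; rewrite eqn_leq ti andbT.
case: i iN ti imin => [|i] iN ti imin.
  have -> : inord 0 = ord0 :> 'I_(\dim {:L}).+1 by apply: val_inj; rewrite /= inordK.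
  by rewrite W0 cap0v dimv0.
have : ~~ (t <= d i)%N.
  by apply: contraTN isT => h; have := imin i; rewrite h (ltnW iN) ltnn => /(_ isT).
have sub : (W (inord i) <= W (inord i.+1))%VS.
  by apply: Wle; rewrite !inordK ?ltnS ?(ltnW iN).
have := dim_cap_step (gr1 L) sub.
by rewrite !Wdim !inordK ?ltnS ?(ltnW iN) // /d; lia.
Qed.

Lemma eta1_step t : (t < #|gr|)%N -> (eta1 W t <= eta1 W t.+1 <= (eta1 W t).+1)%N.
Proof.
move=> lt; rewrite /eta1.
have [i [-> di]] := gr1_flagP (ltnW lt); have [j [-> dj]] := gr1_flagP lt.
have sub : (D i <= D j)%VS by apply: gr1_chain; rewrite di dj.
rewrite (dimvS (capvS sub (subvv _))) /=.
by have := dim_cap_step (semiker (@Fr k L)) sub; rewrite di dj; lia.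
Qed.

(** The index picked by [gr1_flag] is arbitrary, but by [gr1_chain] the intersections with [gr1 L]
    of equal dimension coincide, so the member spanned by [S] may replace it. *)
Lemma eta1_canonical (S : {set X}) :
  (exists j, W j = bspan (B := B) S) ->
  eta1 W #|S :&: gr| = #|[set x in S :&: gr | ~~ tau x]|.
Proof.
move=> [j Wj]; rewrite /eta1.
have Dj : D j = bspan (B := B) (S :&: gr) by rewrite Wj gr1E bspan_capI.
have le : (#|S :&: gr| <= #|gr|)%N by rewrite subset_leq_card ?subsetIr.
have [i [-> di]] := gr1_flagP le.
have /eqP -> : D i == D j.
  by rewrite eqEdim gr1_chain ?Dj ?di ?dim_bspan // leqnn.
rewrite Dj semiker_bspan bspan_capI dim_bspan; congr #|pred_of_set _|.
by apply/setP => x; rewrite !inE.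
Qed.

(** Thresholds on itineraries cut out canonical members, where eta_1 counts those of [k1] and [k2]
    below the threshold. A vector tied with a killed one is itself killed, so crossing the itinerary
    of [k1] or [k2] adds nothing but these vectors. *)
Lemma eta1_jumps_itin (c : nat) (k1 k2 : X) :
  #|gr| = c.+2 -> k1 != k2 -> [set x in gr | ~~ tau x] = [set k1; k2] ->
  (itin k1 <= itin k2)%N ->
  eta1_jumps c W #|[set x in gr | itin x < itin k1]%N|.+1
                 #|[set x in gr | itin x <= itin k2]%N|.
Proof.
move=> cgr n12 kE le12.
pose S th := [set x | itin x < th]%N.
pose G th := [set x in gr | itin x < th]%N.
have SG th : S th :&: gr = G th by apply/setP => x; rewrite !inE andbC.
have etaE th : eta1 W #|G th| = #|[set x in [set k1; k2] | itin x < th]%N|.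
  rewrite -SG eta1_canonical; last exact: canonical_member.
  congr #|pred_of_set _|; apply/setP => x; rewrite -kE SG !inE.
  by case: (x \in gr); case: (tau x); rewrite /= ?andbF ?andbT.
have kin x : x \in gr -> ~~ tau x -> (x = k1) \/ (x = k2).
  move=> xg tx; have : x \in [set x in gr | ~~ tau x] by rewrite !inE xg.
  by rewrite kE !inE => /orP[]/eqP; [left|right].
have [k1g k1t] : k1 \in gr /\ ~~ tau k1.
  have : k1 \in [set x in gr | ~~ tau x] by rewrite kE !inE eqxx.
  by rewrite !inE => /andP.
have [k2g k2t] : k2 \in gr /\ ~~ tau k2.
  have : k2 \in [set x in gr | ~~ tau x] by rewrite kE !inE eqxx orbT.
  by rewrite !inE => /andP.
have same x y : itin x = itin y -> ~~ tau y -> ~~ tau x.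
  by move=> /itin_inj_tau ->.
have vE : [set x in gr | itin x <= itin k2]%N = G (itin k2).+1.
  by apply/setP => x; rewrite !inE.
rewrite vE -/(G (itin k1)).
have eta_lo : eta1 W #|G (itin k1)| = 0%N.
  rewrite etaE; apply/eqP; rewrite cards_eq0; apply/eqP/setP => x.
  rewrite !inE; case: eqP => [->|_]; first by rewrite ltnn.
  by case: eqP => [->|//]; rewrite /= ltnNge le12.
have eta_hi th : (itin k2 < th)%N -> eta1 W #|G th| = 2%N.
  move=> lt; rewrite etaE -[RHS](_ : #|[set k1; k2]| = 2%N); last by rewrite cards2 n12.
  congr #|pred_of_set _|; apply/setP => x; rewrite !inE.
  have [->|_] := eqVneq x k1; first by rewrite (leq_ltn_trans le12 lt).
  by have [->|] := eqVneq x k2; rewrite ?lt.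
have Ggr : exists2 th, (itin k2 < th)%N & #|G th| = c.+2.
  exists (2 ^ (period (@beK k p L B)).+1)%N; first exact: wval_lt.
  rewrite -cgr; congr #|pred_of_set _|; apply/setP => x; rewrite !inE.
  by rewrite /itinerary wval_lt andbT.
have Gle th : (#|G th| <= c.+2)%N.
  by rewrite -cgr subset_leq_card //; apply/fintype.subsetP => x; rewrite !inE => /andP[].
have eta_top : eta1 W c.+2 = 2%N by have [th lt <-] := Ggr; exact: eta_hi.
have step t : (t < c.+2)%N -> (eta1 W t <= eta1 W t.+1 <= (eta1 W t).+1)%N.
  by rewrite -cgr; exact: eta1_step.
have [eta_u [eta_v uv]] :
    [/\ eta1 W #|G (itin k1)|.+1 = 1%N & eta1 W #|G (itin k2).+1|.-1 = 1%N
      /\ (#|G (itin k1)|.+1 < #|G (itin k2).+1|)%N].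
  have [e12|/negPf n12'] := eqVneq (itin k1) (itin k2).
    (* In a tie both vectors enter together and eta_1 rises from 0 to 2 over two dimensions; unit
       steps force the value 1 in between. *)
    have GE : #|G (itin k2).+1| = #|G (itin k1)|.+2.
      rewrite -e12 (_ : G _ = k1 |: (k2 |: G (itin k1))).
        by rewrite !cardsU1 !inE e12 !ltnn !andbF orbF n12.
      apply/setP => x; rewrite !inE ltnS leq_eqVlt.
      have [->|n1] := eqVneq x k1; first by rewrite k1g eqxx.
      have [->|n2] := eqVneq x k2; first by rewrite k2g e12 eqxx.
      case xg: (x \in gr) => //=; case: eqP => // ex.
      have := kin x xg (same _ _ ex k1t).
      by case=> ex'; [rewrite ex' eqxx in n1|rewrite ex' eqxx in n2].
    have h2 := eta_hi _ (ltnSn (itin k2)); rewrite GE in h2 *.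
    have := Gle (itin k2).+1; rewrite GE => l2.
    have eta_u : eta1 W #|G (itin k1)|.+1 = 1%N.
      by have := step _ (ltnW l2); have := step _ l2; rewrite eta_lo h2; lia.
    by rewrite /= eta_u ltnS leqnn.
  (* Without a tie each of the two vectors enters alone. *)
  have lt12 : (itin k1 < itin k2)%N by rewrite ltn_neqAle n12'.
  have GE1 : #|G (itin k1).+1| = #|G (itin k1)|.+1.
    rewrite (_ : G _ = k1 |: G (itin k1)); first by rewrite cardsU1 !inE ltnn andbF.
    apply/setP => x; rewrite !inE ltnS leq_eqVlt.
    have [->|n1] := eqVneq x k1; first by rewrite k1g eqxx.
    case xg: (x \in gr) => //=; case: eqP => // ex.
    case: (kin x xg (same _ _ ex k1t)) => ex'; first by rewrite ex' eqxx in n1.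
    by rewrite -ex ex' ltnn in lt12.
  have GE2 : #|G (itin k2).+1| = #|G (itin k2)|.+1.
    rewrite (_ : G _ = k2 |: G (itin k2)); first by rewrite cardsU1 !inE ltnn andbF.
    apply/setP => x; rewrite !inE ltnS leq_eqVlt.
    have [->|n1] := eqVneq x k2; first by rewrite k2g eqxx.
    case xg: (x \in gr) => //=; case: eqP => // ex.
    case: (kin x xg (same _ _ ex k2t)) => ex'; last by rewrite ex' eqxx in n1.
    by rewrite -ex ex' ltnn in lt12.
  have eta1_mid th : (itin k1 < th)%N -> (th <= itin k2)%N -> eta1 W #|G th| = 1%N.
    move=> l1 l2; rewrite etaE -[RHS](cards1 k1); congr #|pred_of_set _|.
    apply/setP => x; rewrite !inE; have [->|_] := eqVneq x k1; first by rewrite l1.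
    by have [->|//] := eqVneq x k2; rewrite /= ltnNge l2.
  rewrite GE2 /= -GE1 !eta1_mid //; split=> //; split=> //.
  rewrite ltnS subset_leq_card //; apply/fintype.subsetP => x.
  by rewrite !inE => /andP[-> lt]; apply: leq_ltn_trans lt12.
split=> //; apply: unit_step_jumps => //; first by rewrite uv Gle.
exact: eta_hi.
Qed.

End Filtration.
End Jumps.

(** * Monomial bases of direct sums and of the standard modules *)

Section DirectSum.
Variables (k : closedFieldType) (p : nat) (M N : gradedFV k).
Variables (A : monomial p M) (B : monomial p N).

Let X : finType := (idx A + idx B)%type.
Let ebasD (x : X) : dsum M N :=
  match x with inl x => (ebas x, 0) | inr x => (0, ebas x) end.
Let coordD (x : X) (z : dsum M N) : k :=
  match x with inl x => coord x z.1 | inr x => coord x z.2 end.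
Definition dsum_map (f : idx A -> idx A) (g : idx B -> idx B) (x : X) : X :=
  match x with inl x => inl (f x) | inr x => inr (g x) end.
Let tauD (x : X) := match x with inl x => @tau _ _ _ A x | inr x => @tau _ _ _ B x end.
Let cFD (x : X) := match x with inl x => cF x | inr x => cF x end.
Let cVD (x : X) := match x with inl x => cV x | inr x => cV x end.

Let piKD : cancel (dsum_map (@pi _ _ _ A) (@pi _ _ _ B))
                  (dsum_map (@be _ _ _ A) (@be _ _ _ B)).
Proof. by case=> x /=; rewrite piK. Qed.

Let beKD : cancel (dsum_map (@be _ _ _ A) (@be _ _ _ B))
                  (dsum_map (@pi _ _ _ A) (@pi _ _ _ B)).
Proof. by case=> x /=; rewrite beK. Qed.

Let coordPD x c z w : coordD x (c *: z + w) = c * coordD x z + coordD x w.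
Proof. by case: x => x /=; rewrite coordP. Qed.

Let coord_basD x y : coordD x (ebasD y) = (x == y)%:R.
Proof. by case: x y => x [] y /=; rewrite ?coord_bas ?coord0. Qed.

Let coordED z : z = \sum_x coordD x z *: ebasD x.
Proof.
rewrite big_sumType /=; transitivity (in_left N z.1 + in_right M z.2).
  by case: z => u v; congr pair; rewrite /= ?addr0 ?add0r.
congr (_ + _).
  rewrite {1}(coordE A z.1) linear_sum; apply: eq_bigr => x _; exact: linearZ.
rewrite {1}(coordE B z.2) linear_sum; apply: eq_bigr => x _; exact: linearZ.
Qed.

Let cFD_neq0 x : cFD x != 0.
Proof. by case: x => x; exact: cF_neq0. Qed.

Let cVD_neq0 x : cVD x != 0.
Proof. by case: x => x; exact: cV_neq0. Qed.

Let coordD_Fr x (z : dsum M N) :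
  coordD (dsum_map (@pi _ _ _ A) (@pi _ _ _ B) x) (Fr z)
    = if tauD x then frob p (coordD x z) * cFD x else 0.
Proof. by case: x => x; exact: coord_Fr. Qed.

Let coordD_Ve x (z : dsum M N) :
  coordD x (Ve z) = if tauD x then 0
    else frobV p (coordD (dsum_map (@pi _ _ _ A) (@pi _ _ _ B) x) z) * cVD x.
Proof. by case: x => x; exact: coord_Ve. Qed.

Definition dsum_monomial : monomial p (dsum M N) :=
  @Monomial k p (dsum M N) (idx A + idx B)%type ebasD coordD _ _ tauD cFD cVD piKD beKD
    coordPD coord_basD coordED cFD_neq0 cVD_neq0 coordD_Fr coordD_Ve.

End DirectSum.

(** * Frobenius and its inverse as ring maps, and semilinearity of F and V *)

Section FrobAdditive.
Variables (k : closedFieldType) (p : nat) (chp : p \in [pchar k]%R).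

Lemma pchar_gt0 : (0 < p)%N.
Proof. by rewrite prime_gt0 // (pcharf_prime chp). Qed.

Lemma frobD (x y : k) : frob p (x + y) = frob p x + frob p y.
Proof. by rewrite /frob -!(pFrobenius_autE chp) rmorphD. Qed.

Lemma frobM (x y : k) : frob p (x * y) = frob p x * frob p y.
Proof. by rewrite /frob exprMn. Qed.

Lemma frob1 : frob p (1 : k) = 1.
Proof. by rewrite /frob expr1n. Qed.

Lemma frobN (x : k) : frob p (- x) = - frob p x.
Proof. by rewrite /frob -!(pFrobenius_autE chp) rmorphN. Qed.

Lemma frobVD (x y : k) : frobV p (x + y) = frobV p x + frobV p y.
Proof. by rewrite -[RHS](frobKV _ chp) frobD !(frobVK _ pchar_gt0). Qed.

Lemma frobVM (x y : k) : frobV p (x * y) = frobV p x * frobV p y.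
Proof. by rewrite -[RHS](frobKV _ chp) frobM !(frobVK _ pchar_gt0). Qed.

Lemma semiext_semilinear (s : k -> k) m (f : nat -> nat -> 'M[k]_(2, m.+1)) :
  (forall x y, s (x + y) = s x + s y) -> (forall x y, s (x * y) = s x * s y) ->
  semilinear s (semiext s f).
Proof.
move=> sD sM c x y; rewrite /semiext scaler_sumr -big_split /=.
apply: eq_bigr => i _; rewrite scaler_sumr -big_split /=.
by apply: eq_bigr => j _; rewrite !mxE sD sM scalerDl scalerA.
Qed.

Lemma dsum_dieudonne (M N : gradedFV k) :
  dieudonne p M -> dieudonne p N -> dieudonne p (dsum M N).
Proof.
by move=> [FM VM] [FN VN]; split=> c x y; congr pair;
  rewrite ?FM ?FN ?VM ?VN.
Qed.

Lemma stdM_dieudonne m a : dieudonne p (stdM k p m a).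
Proof.
split; apply: semiext_semilinear; [exact: frobD|exact: frobM|exact: frobVD|].
exact: frobVM.
Qed.

End FrobAdditive.

(** * The standard modules in their given basis *)

Section StdMaps.
Variables (m a : nat) (ham : (a <= m)%N).

(* The pair [(g, s)] of ordinals stands for the basis vector e_{g+1,s+1}. *)
Definition std_pi (x : 'I_2 * 'I_m.+1) : 'I_2 * 'I_m.+1 :=
  let: (g, s) := x in
  if g == 0 then
    (1, inord (if (s < a)%N then s : nat else if s == a :> nat then m else s.-1))
  else
    (0, inord (if (s < m - a)%N then s.+1 else if s == (m - a)%N :> nat then 0%N else s)).

Definition std_be (x : 'I_2 * 'I_m.+1) : 'I_2 * 'I_m.+1 :=
  let: (g, s) := x in
  if g == 0 then
    (1, inord (if s == 0%N :> nat then (m - a)%N else if (s <= m - a)%N then s.-1 else s))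
  else
    (0, inord (if (s < a)%N then s : nat else if s == m :> nat then a else s.+1)).

Definition std_tau (x : 'I_2 * 'I_m.+1) : bool :=
  if x.1 == 0 then x.2 != a :> nat else x.2 == (m - a)%N :> nat.

Lemma ord2P (g : 'I_2) : g = 0 \/ g = 1.
Proof. by case: g => [[|[|//]] i]; [left|right]; apply: val_inj. Qed.

Lemma std_piK : cancel std_pi std_be.
Proof.
case=> g s; have := ltn_ord s; case: (ord2P g) => -> lts /=;
  congr pair; apply: val_inj; rewrite /= ?inordK; repeat case: ifPn; lia.
Qed.

Lemma std_beK : cancel std_be std_pi.
Proof.
case=> g s; have := ltn_ord s; case: (ord2P g) => -> lts /=;
  congr pair; apply: val_inj; rewrite /= ?inordK; repeat case: ifPn; lia.
Qed.

End StdMaps.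

Section StdMonomial.
Variables (k : closedFieldType) (p : nat).
Variables (m a : nat) (ham : (a <= m)%N).

Local Notation X := ('I_2 * 'I_m.+1)%type.
Local Notation dl x := (delta_mx x.1 x.2 : 'M[k]_(2, m.+1)).

Lemma bas_delta (i : 'I_2) (j : 'I_m.+1) : bas k m i.+1 j.+1 = delta_mx i j.
Proof. by apply/matrixP => r s; rewrite !mxE !eqSS. Qed.

Lemma bas_delta_inord (i : 'I_2) (j : nat) : (j <= m)%N ->
  bas k m i.+1 j.+1 = delta_mx i (inord j).
Proof. by move=> le; rewrite -bas_delta inordK. Qed.

Lemma F_bas_delta (x : X) :
  F_bas k m a x.1.+1 x.2.+1 = if std_tau a x then dl (std_pi a x) else 0.
Proof.
case: x => g s; have lts := ltn_ord s; rewrite /F_bas /std_tau.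
case: (ord2P g) => -> /=; rewrite ?eqSS.
  have [lt|ge] := ltnP s a; first by rewrite (ltn_eqF lt) /= (bas_delta_inord 1) //; lia.
  have [//|ne] := eqVneq (s : nat) a.
  by rewrite /= -(bas_delta_inord 1) /=; [congr bas|]; lia.
rewrite subSn // eqSS; case: eqP => //= ->; rewrite ltnn.
by rewrite (bas_delta_inord 0).
Qed.

Lemma V_bas_delta (x : X) :
  V_bas k m a x.1.+1 x.2.+1
    = if std_tau a (std_be a x) then 0 else dl (std_be a x).
Proof.
case: x => g s; have lts := ltn_ord s; rewrite /V_bas /std_tau.
case: (ord2P g) => -> /=; rewrite ?eqSS.
  have [_|s0] := eqVneq (s : nat) 0%N.
    by rewrite inordK ?eqxx //; lia.
  rewrite inordK; last by case: ifP; lia.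
  rewrite subSn // ltnS; case: (leqP s (m - a)) => h.
    rewrite ifN; last by lia.
    by rewrite -(bas_delta_inord 1) ?prednK ?lt0n //; lia.
  rewrite ifN; last by lia.
  by rewrite -(bas_delta_inord 1).
have [sa|sa] := ltnP s a.
  by rewrite inordK // (ltn_eqF sa) ltn_eqF // (leq_trans sa).
case: eqP => sm.
  by rewrite inordK ?eqxx // (bas_delta_inord 0).
rewrite inordK ?ifT //; lia.
Qed.

Lemma semiextE (s : k -> k) f (z : 'M[k]_(2, m.+1)) :
  semiext s f z = \sum_(x : X) s (z x.1 x.2) *: f x.1.+1 x.2.+1.
Proof. by rewrite /semiext pair_bigA. Qed.

Lemma std_coord_Fr (x : X) (z : stdM k p m a) :
  (Fr z : 'M_(2, m.+1)) (std_pi a x).1 (std_pi a x).2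
    = if std_tau a x then frob p ((z : 'M_(2, m.+1)) x.1 x.2) * 1 else 0.
Proof.
rewrite /= semiextE summxE (bigD1 x) //= big1 => [|y nyx].
  by rewrite addr0 F_bas_delta mxE; case: ifP; rewrite mxE ?eqxx ?mulr0.
rewrite F_bas_delta mxE; case: ifP => _; rewrite mxE ?mulr0 //.
rewrite -xpair_eqE -!surjective_pairing.
by rewrite (inj_eq (can_inj (std_piK ham))) eq_sym (negPf nyx) mulr0.
Qed.

Lemma std_coord_Ve (x : X) (z : stdM k p m a) :
  (Ve z : 'M_(2, m.+1)) x.1 x.2
    = if std_tau a x then 0
      else frobV p ((z : 'M_(2, m.+1)) (std_pi a x).1 (std_pi a x).2) * 1.
Proof.
rewrite /= semiextE summxE (bigD1 (std_pi a x)) //= big1 => [|y nyx].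
  rewrite addr0 V_bas_delta (std_piK ham) mxE.
  by case: ifP; rewrite mxE ?eqxx ?mulr0.
rewrite V_bas_delta mxE; case: ifP => _; rewrite mxE ?mulr0 //.
rewrite -xpair_eqE -!surjective_pairing.
by rewrite eq_sym (can2_eq (std_beK ham) (std_piK ham)) (negPf nyx) mulr0.
Qed.

Let std_coordP (x : X) c (z w : 'M[k]_(2, m.+1)) :
  (c *: z + w) x.1 x.2 = c * z x.1 x.2 + w x.1 x.2.
Proof. by rewrite !mxE. Qed.

Let std_coord_bas (x y : X) : dl y x.1 x.2 = (x == y)%:R.
Proof. by case: x y => g s [g' s']; rewrite mxE. Qed.

Let std_coordE (z : 'M[k]_(2, m.+1)) : z = \sum_(x : X) z x.1 x.2 *: dl x.
Proof. by rewrite {1}[z]matrix_sum_delta pair_bigA. Qed.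

Let one_neq0 (x : X) : (1 : k) != 0.
Proof. exact: oner_neq0. Qed.

Definition std_monomial : monomial p (stdM k p m a) :=
  @Monomial k p (stdM k p m a) ('I_2 * 'I_m.+1)%type (fun x => dl x)
    (fun x (z : 'M_(2, m.+1)) => z x.1 x.2) _ _ (std_tau a) (fun=> 1) (fun=> 1)
    (std_piK ham) (std_beK ham) std_coordP std_coord_bas std_coordE one_neq0 one_neq0
    std_coord_Fr std_coord_Ve.

Lemma std_gr (i : 'I_2) :
  <<[seq bas k m i.+1 j | j <- iota 1 m.+1]>>%VS
    = bspan (B := std_monomial) [set x : X | x.1 == i].
Proof.
apply/eqP; rewrite eqEsubv; apply/andP; split.
  apply/span_subvP => _ /mapP [j + ->]; rewrite mem_iota => /andP[].
  case: j => // j _; rewrite add1n ltnS => lt.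
  apply/(mem_bspan (B := std_monomial)) => /= x; rewrite inE.
  by rewrite (bas_delta_inord i) -1?ltnS // mxE => /negPf ->.
apply/subv_sumP => x; rewrite inE => /eqP xi; rewrite -memvE; apply: memv_span.
apply/mapP; exists x.2.+1; first by rewrite mem_iota /= add1n ltnS.
by rewrite -xi bas_delta.
Qed.

End StdMonomial.

(** * The sum and difference basis for 0 < m = a *)

Section Ordinary.
Variables (k : closedFieldType) (p : nat) (chp : p \in [pchar k]).
Hypothesis two_neq0 : (2 : k) != 0.
Variables (m : nat) (m_gt0 : (0 < m)%N).

Local Notation X := ('I_2 * 'I_m.+1)%type.
Local Notation M2 := 'M[k]_(2, m.+1).

Let edge (s : 'I_m.+1) := (s == 0%N :> nat) || (s == m :> nat).
Let sg (g : 'I_2) : k := (-1) ^+ g.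

(* When [a = m], F permutes e_{1,1} and e_{2,1}, and V^-1 permutes e_{1,m+1} and
   e_{2,m+1}; the sum and the difference are fixed up to sign. *)
Definition ord_ebas (x : X) : M2 :=
  let: (g, s) := x in
  if edge s then delta_mx 0 s + sg g *: delta_mx 1 s else delta_mx g s.

Definition ord_coord (x : X) (z : M2) : k :=
  let: (g, s) := x in
  if edge s then (z 0 s + sg g * z 1 s) / 2 else z g s.

Definition ord_pi (x : X) : X :=
  let: (g, s) := x in if edge s then (g, s) else (rev_ord g, s).

Definition ord_tau (x : X) : bool :=
  let: (g, s) := x in
  if s == 0%N :> nat then true else if s == m :> nat then false else g == 0.

(** For a sign s, F sends e_{1,1} + s e_{2,1} to e_{2,1} + s e_{1,1}, which is s times the original
    vector; V does the same to e_{1,m+1} + s e_{2,m+1}. *)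
Let ord_c (x : X) : k := if edge x.2 then sg x.1 else 1.

Lemma ord_piK : involutive ord_pi.
Proof. by case=> g s /=; case es: (edge s); rewrite /= es ?rev_ordK. Qed.

Let sg1 : sg 1 = -1. Proof. by rewrite /sg expr1. Qed.
Let sg0 : sg 0 = 1. Proof. by rewrite /sg expr0. Qed.

Lemma ord_coordP x c (z w : M2) :
  ord_coord x (c *: z + w) = c * ord_coord x z + ord_coord x w.
Proof. by case: x => g s /=; case: ifP => _; rewrite !mxE //; field. Qed.

Lemma ord_coord_bas x y : ord_coord x (ord_ebas y) = (x == y)%:R.
Proof.
case: x y => g s [h t] /=; rewrite xpair_eqE.
have [<-|nst] := eqVneq s t.
  case: (edge s); rewrite !mxE ?eqxx ?andbT //.
  by case: (ord2P g) => ->; case: (ord2P h) => ->;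
    rewrite ?sg1 ?sg0 /= ?mulr1n ?mulr0n; field.
rewrite andbF; case: (edge s); case: (edge t); rewrite !mxE (negPf nst) ?andbF /=;
  by rewrite ?mulr0n ?mulr0 ?addr0 ?mul0r ?mulr0 ?addr0 ?mul0r.
Qed.

Lemma ord_coordE (z : M2) : z = \sum_x ord_coord x z *: ord_ebas x.
Proof.
have -> : \sum_x ord_coord x z *: ord_ebas x
    = \sum_g \sum_s ord_coord (g, s) z *: ord_ebas (g, s).
  by rewrite pair_bigA; apply: eq_bigr => -[].
apply/matrixP => i j; rewrite exchange_big summxE (bigD1 j) //= [X in _ + X]big1 => [|s nsj].
  rewrite addr0 !big_ord_recl big_ord0 addr0 mxE.
  have -> : lift ord0 ord0 = 1 :> 'I_2 by apply: val_inj.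
  rewrite -[ord0]/(0 : 'I_2) sg0 sg1.
  by case: (edge j); case: (ord2P i) => ->; rewrite !mxE !eqxx /= ?mulr1n ?mulr0n; field.
rewrite summxE big1 // => g _; rewrite mxE; case: (edge s); rewrite !mxE;
  by rewrite [j == s]eq_sym (negPf nsj) ?andbF ?mulr0 ?addr0 ?mulr0.
Qed.

Lemma frob_half : frob p (2^-1 : k) = 2^-1.
Proof.
apply: (mulfI two_neq0); rewrite mulfV //.
have {1}-> : (2 : k) = frob p 2 by rewrite -[2]/(1 + 1) frobD // frob1.
by rewrite -frobM mulfV // frob1.
Qed.

Lemma frob_sg g : frob p (sg g) = sg g.
Proof. by case: (ord2P g) => ->; rewrite ?sg0 ?sg1 ?frobN ?frob1. Qed.

Lemma frobV_half : frobV p (2^-1 : k) = 2^-1.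
Proof. by rewrite -{1}frob_half frobKV. Qed.

Lemma frobV_sg g : frobV p (sg g) = sg g.
Proof. by rewrite -{1}frob_sg frobKV. Qed.

Let L := stdM k p m m.

Let FrE (g : 'I_2) (s : 'I_m.+1) (z : L) : (Fr z : M2) g s =
  if g == 0 then (if s == 0%N :> nat then frob p ((z : M2) 1 0) else 0)
  else (if (s < m)%N then frob p ((z : M2) 0 s) else 0).
Proof.
have := std_coord_Fr (leqnn m) (std_be m (g, s)) z.
rewrite (std_beK (leqnn m)) /= => ->; rewrite mulr1 /std_tau.
have inord_val (i : 'I_m.+1) : inord i = i by exact: inord_val.
have inord0 : inord 0 = 0 :> 'I_m.+1 by apply: val_inj; rewrite /= inordK.
case: (ord2P g) => -> /=; rewrite ?subnn.
  have [_|s0] := eqVneq (s : nat) 0%N; first by rewrite inord0.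
  by rewrite leqn0 (negPf s0) inord_val (negPf s0).
have [lt|ge] := ltnP s m; first by rewrite inord_val (ltn_eqF lt).
have -> : s == m :> nat by rewrite eqn_leq ge -ltnS ltn_ord.
by rewrite inordK ?eqxx.
Qed.

Let VeE (g : 'I_2) (s : 'I_m.+1) (z : L) : (Ve z : M2) g s =
  if g == 0 then (if s == m :> nat then frobV p ((z : M2) 1 s) else 0)
  else (if (0 < s)%N then frobV p ((z : M2) 0 s) else 0).
Proof.
have := std_coord_Ve (leqnn m) (g, s) z; rewrite /= => ->; rewrite mulr1 /std_tau.
case: (ord2P g) => -> /=; rewrite ?subnn.
  have [sm|] := eqVneq (s : nat) m; last by [].
  by rewrite sm ltnn; congr (frobV p (_ _ _)); apply: val_inj; rewrite /= inordK.
by rewrite lt0n; case: eqP => //= _; rewrite inord_val.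
Qed.

Lemma ord_coord_Fr (x : X) (z : L) :
  ord_coord (ord_pi x) (Fr z)
    = if ord_tau x then frob p (ord_coord x z) * ord_c x else 0.
Proof.
case: x => g s; rewrite /ord_c /=; case es: (edge s) => /=; rewrite es.
  rewrite !FrE /=; have [s0|s0] := eqVneq (s : nat) 0%N.
    have -> : s = 0 by apply: val_inj.
    rewrite m_gt0 !frobM !frobD // frobM frob_half frob_sg.
    by case: (ord2P g) => ->; rewrite ?sg0 ?sg1; field.
  move: es; rewrite /edge (negPf s0) /= => /eqP ->.
  by rewrite eqxx ltnn mulr0 addr0 mul0r.
move: es; rewrite /edge => /norP [s0 sm].
rewrite FrE (negPf s0) (negPf sm) mulr1.
have lts : (s < m)%N by have := ltn_ord s; lia.
by case: (ord2P g) => ->; rewrite /= ?lts.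
Qed.

Lemma ord_coord_Ve (x : X) (z : L) :
  ord_coord x (Ve z)
    = if ord_tau x then 0 else frobV p (ord_coord (ord_pi x) z) * ord_c x.
Proof.
case: x => g s; rewrite /ord_c /=; case es: (edge s) => /=; rewrite es.
  rewrite !VeE /=; have [s0|s0] := eqVneq (s : nat) 0%N.
    by rewrite s0 (ltn_eqF m_gt0) // ltnn mulr0 addr0 mul0r.
  move: es; rewrite /edge (negPf s0) /= => es; rewrite es lt0n s0.
  rewrite !(frobVM, frobVD) // frobV_half frobV_sg.
  by case: (ord2P g) => ->; rewrite ?sg0 ?sg1; field.
move: es; rewrite /edge => /norP [s0 sm].
rewrite VeE (negPf s0) (negPf sm) mulr1 lt0n s0.
case: (ord2P g) => -> //=; congr (frobV p (_ _ _)); exact: val_inj.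
Qed.

Let ord_c_neq0 x : ord_c x != 0.
Proof.
rewrite /ord_c; case: ifP => _; last exact: oner_neq0.
by rewrite /sg expf_neq0 // oppr_eq0 oner_neq0.
Qed.

Definition ord_monomial : monomial p L :=
  @Monomial k p L ('I_2 * 'I_m.+1)%type ord_ebas ord_coord _ _ ord_tau ord_c ord_c ord_piK
    ord_piK ord_coordP ord_coord_bas ord_coordE ord_c_neq0 ord_c_neq0 ord_coord_Fr
    ord_coord_Ve.

(** Orbits have at most two elements, and the two vectors of an orbit of size 2 differ in their
    first letter. *)
Lemma ord_primitive : primitive ord_monomial.
Proof.
suff h (x : X) n : word ord_pi ord_tau (iter n ord_pi x) =1 word ord_pi ord_tau x ->
    iter n ord_pi x = x.
  exact: h.
have [-> //|] : iter n ord_pi x = x \/ iter n ord_pi x = ord_pi x.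
  by elim: n => [|n [] /= ->]; [left|right|left; rewrite ord_piK].
move=> -> /(_ 0%N); rewrite /word /= ord_piK; case: x => g s /=.
case es: (edge s) => //= /negb_inj; move: es; rewrite /edge => /norP [s0 sm].
by rewrite (negPf s0) (negPf sm); case: (ord2P g) => ->.
Qed.

End Ordinary.

(** * Itineraries in the standard modules *)

Local Close Scope ring_scope.

Lemma lexlt_shift c (f g : nat -> bool) :
  (forall i, i < c -> f i = g i) ->
  lexlt (fun i => f (c + i)) (fun i => g (c + i)) -> lexlt f g.
Proof.
move=> e [t [h ft gt]]; exists (c + t); split=> // i lt.
by have [/e //|le] := ltnP i c; have := h (i - c); rewrite subnKC //; apply; lia.
Qed.

Lemma eq_lexlt (f g f' g' : nat -> bool) :
  f =1 f' -> g =1 g' -> lexlt f g -> lexlt f' g'.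
Proof.
by move=> ef eg [t [h ft gt]]; exists t; split=> [i /h||];
  rewrite -?ef -?eg.
Qed.

(* [c] codes the first position at which the word leaves (VF)^oo: a word
   (VF)^i F.. has code [i], a word (VF)^i VV.. has code [2B - i], and the word
   (VF)^oo has code [B]; the lexicographic order is increasing in the code. *)
Definition vf_run (f : nat -> bool) (i : nat) : Prop :=
  forall t, t < i -> f t.*2 = true /\ f t.*2.+1 = false.

Definition has_code (B : nat) (f : nat -> bool) (c : nat) : Prop :=
  [\/ [/\ c < B, vf_run f c & f c.*2 = false],
      c = B /\ (forall i, vf_run f i)
    | exists i, [/\ i < B, c = B.*2 - i, vf_run f i, f i.*2 & f i.*2.+1]].

Lemma vf_run_le f i j : j <= i -> vf_run f i -> vf_run f j.
Proof. by move=> le h t lt; apply: h; apply: leq_trans le. Qed.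

Lemma vf_run_eq f g i : vf_run f i -> vf_run g i -> forall j, j < i.*2 -> f j = g j.
Proof.
move=> hf hg j lt; have lt2 : j./2 < i by lia.
have [f0 f1] := hf _ lt2; have [g0 g1] := hg _ lt2.
by rewrite -(odd_double_half j); case: (odd j); rewrite ?add1n ?add0n ?f0 ?g0 ?f1 ?g1.
Qed.

Lemma vf_run_step (f : nat -> bool) i :
  f 0 = true -> f 1 = false -> vf_run (fun t => f t.+2) i -> vf_run f i.+1.
Proof. by move=> f0 f1 h [|t] // lt; have := h t lt; rewrite doubleS. Qed.

Lemma lexlt_even f g i :
  vf_run f i -> vf_run g i -> f i.*2 = false -> g i.*2 = true -> lexlt f g.
Proof. by move=> hf hg f0 g0; exists i.*2; split=> // j; exact: vf_run_eq. Qed.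

Lemma lexlt_odd f g i :
  vf_run f i.+1 -> vf_run g i -> g i.*2 -> g i.*2.+1 -> lexlt f g.
Proof.
move=> hf hg g0 g1; have [f0 f1] := hf i (ltnSn i).
exists i.*2.+1; split=> // j; rewrite ltnS leq_eqVlt => /orP[/eqP -> |].
  by rewrite f0 g0.
by apply: vf_run_eq => //; apply: vf_run_le hf.
Qed.

(** Leaving (VF)^oo through F happens at an even position and makes a word smaller; leaving it
    through VV happens at an odd position and makes it larger. The earlier of two exits decides. *)
Lemma code_lexlt B f g c d : has_code B f c -> has_code B g d -> c < d -> lexlt f g.
Proof.
case=> [[cB hf f0]|[-> hf]|[i [iB -> hf f0 f1]]];
  case=> [[dB hg g0]|[-> hg]|[j [jB -> hg g0 g1]]] lt; try lia.
- by have [g0' _] := hg c lt; apply: lexlt_even f0 g0' => //; apply: vf_run_le hg; lia.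
- by have [g0' _] := hg c.+1 c (ltnSn c); apply: lexlt_even f0 g0'.
- have [cj|jc|e] := ltngtP c j.
  + have [g0' _] := hg c cj; apply: lexlt_even f0 g0' => //; apply: vf_run_le hg; lia.
  + by apply: lexlt_odd g0 g1 => //; apply: vf_run_le hf; lia.
  + by subst j; apply: lexlt_even f0 g0.
- exact: lexlt_odd g0 g1.
- by apply: lexlt_odd g0 g1 => //; apply: vf_run_le hf; lia.
Qed.

Lemma lexlt_neq f g : lexlt f g -> ~ f =1 g.
Proof. by move=> [t [_ ft gt]] e; rewrite -e ft in gt. Qed.

(** * Words of the degree-1 vectors of one standard module *)

Section StdWords.
Variables (m a : nat) (ham : a <= m).

Local Notation be := (@std_be m a).
Local Notation pi := (@std_pi m a).
Local Notation tau := (@std_tau m a).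

Definition pt (g : 'I_2) (s : nat) : 'I_2 * 'I_m.+1 := (g, inord s).

Definition back1 (s : nat) : nat :=
  if s == 0 then m - a else if s <= m - a then s.-1 else s.

Definition back2 (s : nat) : nat :=
  if s < a then s else if s == m then a else s.+1.

Lemma back1_le s : s <= m -> back1 s <= m.
Proof. by rewrite /back1; repeat case: ifP; lia. Qed.

Lemma back2_le s : s <= m -> back2 s <= m.
Proof. by rewrite /back2; repeat case: ifP; lia. Qed.

Lemma be_pt0 s : s <= m -> be (pt 0%R s) = pt 1%R (back1 s).
Proof. by move=> le; rewrite /pt /= inordK. Qed.

Lemma be_pt1 s : s <= m -> be (pt 1%R s) = pt 0%R (back2 s).
Proof. by move=> le; rewrite /pt /= inordK. Qed.

Lemma tau_pt0 s : s <= m -> tau (pt 0%R s) = (s != a).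
Proof. by move=> le; rewrite /std_tau /= inordK. Qed.

Lemma tau_pt1 s : s <= m -> tau (pt 1%R s) = (s == m - a).
Proof. by move=> le; rewrite /std_tau /= inordK. Qed.

Lemma ptP x : exists g s, s <= m /\ x = pt g s.
Proof. by case: x => g s; exists g, s; rewrite -ltnS ltn_ord /pt inord_val. Qed.

Definition wd (s : nat) : nat -> bool := word be tau (pt 0%R s).

Lemma word_pt0_0 s : s <= m -> word be tau (pt 0%R s) 0 = (s != 0).
Proof.
move=> le; rewrite /word iterS be_pt0 // tau_pt1 ?back1_le // /back1.
by repeat case: ifP; lia.
Qed.

Lemma word_pt1_0 s : s <= m -> word be tau (pt 1%R s) 0 = (s == m).
Proof.
move=> le; rewrite /word iterS be_pt1 // tau_pt0 ?back2_le // /back2.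
by repeat case: ifP; lia.
Qed.

Lemma wd0 s : s <= m -> wd s 0 = (s != 0).
Proof. exact: word_pt0_0. Qed.

Lemma wd1 s : s <= m -> wd s 1 = (back1 s == m).
Proof. by move=> le; rewrite /wd wordS be_pt0 // word_pt1_0 ?back1_le. Qed.

Lemma wdSS s t : s <= m -> wd s t.+2 = wd (back2 (back1 s)) t.
Proof. by move=> le; rewrite /wd !wordS be_pt0 // be_pt1 ?back1_le. Qed.

(** The boundary index [m - minn a (m - a)] behaves differently in the two cases: for [2 * a < m]
    two steps back fix it, while for [m < 2 * a] it equals [a] and belongs to the indices that climb
    towards [m]. *)
Definition upper (s : nat) : bool :=
  if 2 * a <= m then m - minn a (m - a) < s else m - minn a (m - a) <= s.

Definition std_code (B s : nat) : nat :=
  if s <= minn a (m - a) then s else if upper s then B.*2 - (m - s) else B.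

(** In this range two steps back lower the index by one and contribute the letters VF. *)
Lemma wd_lower s : s <= minn a (m - a) ->
  vf_run (wd s) s /\ forall t, wd s (s.*2 + t) = wd 0 t.
Proof.
elim: s => [|s IH] le; first by [].
have [IH1 IH2] := IH ltac:(lia).
have e t : wd s.+1 t.+2 = wd s t.
  by rewrite wdSS; [congr wd; rewrite /back1 /back2; repeat case: ifP|]; lia.
have e1 : wd s.+1 1 = false.
  by rewrite wd1; [rewrite /back1; repeat case: ifP|]; lia.
split; last by move=> t; rewrite doubleS !addSn e.
apply: vf_run_step => //; first by rewrite wd0 //; lia.
by move=> t lt; rewrite !e; apply: IH1.
Qed.

(** In this range two steps back raise the index by one, again with the letters VF, until [m] is
    reached. *)
Lemma wd_upper i : i <= m -> upper (m - i) ->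
  vf_run (wd (m - i)) i /\ forall t, wd (m - i) (i.*2 + t) = wd m t.
Proof.
elim: i => [|i IH] le up; first by rewrite subn0.
move: (up); rewrite /upper => up'.
have [IH1 IH2] := IH ltac:(lia) ltac:(rewrite /upper; move: up'; case: ifP; lia).
have e t : wd (m - i.+1) t.+2 = wd (m - i) t.
  rewrite wdSS; last by lia.
  by congr wd; move: up'; rewrite /back1 /back2; repeat case: ifP; lia.
have e1 : wd (m - i.+1) 1 = false.
  by rewrite wd1; [move: up'; rewrite /back1; repeat case: ifP|]; lia.
split; last by move=> t; rewrite doubleS !addSn e.
apply: vf_run_step => //; first by rewrite wd0; move: up'; case: ifP; lia.
by move=> t lt; rewrite !e; apply: IH1.
Qed.

Lemma back_neutral s : s <= m -> minn a (m - a) < s -> ~~ upper s ->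
  back2 (back1 s) = s.
Proof.
by rewrite /upper /back1 /back2 => le lo; repeat case: ifP; lia.
Qed.

Lemma wd_neutral s : s <= m -> minn a (m - a) < s -> ~~ upper s ->
  forall i, vf_run (wd s) i.
Proof.
move=> le lo up; elim=> [//|i IH]; apply: vf_run_step.
- by rewrite wd0 //; lia.
- by rewrite wd1 //; move: up; rewrite /upper /back1; repeat case: ifP; lia.
by move=> t lt; rewrite !wdSS // back_neutral //; apply: IH.
Qed.

Lemma wd_top : upper m -> [/\ wd m 0, wd m 1 & forall t, wd m t.+2 = wd a t].
Proof.
rewrite /upper => up; split.
- by rewrite wd0 //; move: up; case: ifP; lia.
- by rewrite wd1 //; move: up; rewrite /back1; repeat case: ifP; lia.
by move=> t; rewrite wdSS //; congr wd; move: up; rewrite /back1 /back2;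
  repeat case: ifP; lia.
Qed.

Lemma upper_top s : s <= m -> upper s -> upper m.
Proof. by rewrite /upper => le; case: ifP; lia. Qed.

Lemma wd_code B s : m < B -> s <= m -> has_code B (wd s) (std_code B s).
Proof.
move=> mB le; rewrite /std_code; case: ifP => lo.
  have [run sh] := wd_lower lo; apply: Or31; split=> //; first by lia.
  by rewrite -[s.*2]addn0 sh wd0.
case: ifP => up.
  have up' : upper (m - (m - s)) by rewrite subKn.
  have [run sh] := wd_upper (leq_subr _ _) up'; rewrite subKn // in run sh.
  have [t0 t1 _] := wd_top (upper_top le up).
  apply: Or33; exists (m - s); split=> //; first by lia.
    by rewrite -[_.*2]addn0 sh.
  by rewrite -[_.*2.+1]addn1 sh.
by apply: Or32; split=> // i; apply: wd_neutral => //; rewrite ?up //; lia.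
Qed.

End StdWords.

(** * Primitivity of the given basis outside the case 0 < m = a *)

Section StdPrimitive.
Variables (m a : nat) (ham : a <= m).

Local Notation be := (@std_be m a).
Local Notation pi := (@std_pi m a).
Local Notation tau := (@std_tau m a).
Local Notation word := (word be tau).

Let tied x y := word x =1 word y.

Let tied_be x y : tied x y -> tied (be x) (be y).
Proof. by move=> e t; rewrite -!wordS e. Qed.

Let iter_be n x : be (iter n pi x) = iter n pi (be x).
Proof.
elim: n => //= n <-.
by rewrite (std_piK ham) (std_beK ham).
Qed.

(** Equal words have equal codes, and a code determines the index unless the vector is neutral. A
    neutral vector is fixed by [pi] applied twice, so its orbit has only one vector in its degree.
    Degree 2 reduces to degree 1 by one step back. *)
Let tied_same_grade n g s t : s <= m -> t <= m ->
  iter n pi (pt m g s) = pt m g t -> tied (pt m g t) (pt m g s) ->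
  pt m g t = pt m g s.
Proof.
have key i u v : u <= m -> v <= m -> iter i pi (pt m 0%R u) = pt m 0%R v ->
    tied (pt m 0%R v) (pt m 0%R u) -> pt m 0%R v = pt m 0%R u.
  move=> um vm e w.
  have cu := wd_code ham (ltnSn m) um; have cv := wd_code ham (ltnSn m) vm.
  have ce : std_code m a m.+1 u = std_code m a m.+1 v.
    case: (ltngtP (std_code m a m.+1 u) (std_code m a m.+1 v)) => // lt.
      by case: (lexlt_neq (code_lexlt cu cv lt)) => x; rewrite /wd w.
    by case: (lexlt_neq (code_lexlt cv cu lt)) => x; rewrite /wd w.
  have [-> //|nuv] := eqVneq u v.
  have [lo up] : minn a (m - a) < u /\ ~~ upper m a u.
    by move: ce; rewrite /std_code /upper; repeat case: ifP; lia.
  have bb : be (be (pt m 0%R u)) = pt m 0%R u.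
    by rewrite be_pt0 // be_pt1 ?back1_le // back_neutral.
  have pp : pi (pi (pt m 0%R u)) = pt m 0%R u.
    by rewrite -{1}bb !(std_beK ham).
  have : iter i pi (pt m 0%R u) = pt m 0%R u \/ iter i pi (pt m 0%R u) = pi (pt m 0%R u).
    by elim: i {e} => [|i [] /= ->]; [left|right|left].
  by rewrite e => -[//|] /(congr1 fst).
case: (ord2P g) => -> sm tm e w; first exact: key e w.
apply: (can_inj (std_beK ham)); rewrite !be_pt1 //.
apply: (key n); rewrite ?back2_le // -?be_pt1 //; last exact: tied_be.
by rewrite -iter_be e.
Qed.

(** The first three letters already separate the two degrees. *)
Let no_cross_tie s t : 0 < a < m -> s <= m -> t <= m ->
  ~ tied (pt m 0%R s) (pt m 1%R t).
Proof.
move=> am sm tm w.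
have w0 := w 0; have w1 := w 1; have w2 := w 2.
have b1 := back1_le ham sm; have b2 := back2_le ham tm.
move: w0 w1 w2; rewrite word_pt0_0 // word_pt1_0 //.
rewrite !wordS be_pt0 // be_pt1 // word_pt0_0 // word_pt1_0 //.
rewrite be_pt1 // be_pt0 // word_pt0_0 ?back2_le // word_pt1_0 ?back1_le //.
by rewrite /back1 /back2; repeat case: ifP; lia.
Qed.

Lemma std_primitive_iter n x : (0 < m -> a < m) ->
  word (iter n pi x) =1 word x -> iter n pi x = x.
Proof.
move=> am; have [g [s [sm ->]]] := ptP x.
have [h [t [tm e]]] := ptP (iter n pi (pt m g s)); rewrite e => w.
have [gh|ngh] := eqVneq h g; first by subst h; exact: tied_same_grade e w.
have [a0|a_gt0] := posnP a; last first.
  have am' : 0 < a < m by rewrite a_gt0 am //; apply: leq_trans ham.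
  by case: (ord2P g) ngh w => ->; case: (ord2P h) => -> // _ w;
    [case: (no_cross_tie am' sm tm) => i|case: (no_cross_tie am' tm sm)].
(* For [a = 0] every word alternates between V and F, and [be] is an involution. The two vectors of
   an orbit thus have opposite words. *)
have alt y : word y 1 = ~~ word y 0.
  have [g' [u [um ->]]] := ptP y; case: (ord2P g') => ->; rewrite wordS.
    rewrite be_pt0 // word_pt1_0 ?back1_le // word_pt0_0 // /back1 a0.
    by repeat case: ifP; lia.
  rewrite be_pt1 // word_pt0_0 ?back2_le // word_pt1_0 // /back2 a0.
  by repeat case: ifP; lia.
have inv y : be (be y) = y.
  have [g' [u [um ->]]] := ptP y; case: (ord2P g') => ->.
    rewrite be_pt0 // be_pt1 ?back1_le //; congr pt.
    by rewrite /back1 /back2 a0; repeat case: ifP; lia.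
  rewrite be_pt1 // be_pt0 ?back2_le //; congr pt.
  by rewrite /back1 /back2 a0; repeat case: ifP; lia.
have pinv y : pi (pi y) = y by rewrite -{1}(inv y) !(std_beK ham).
have pibe y : pi y = be y by rewrite -{1}(inv y) (std_beK ham).
have : iter n pi (pt m g s) = pt m g s \/ iter n pi (pt m g s) = be (pt m g s).
  elim: n {e} => [|n]; first by left.
  by rewrite iterS => -[] ->; [right; rewrite pibe|left; rewrite -pibe pinv].
rewrite e => -[//|eb]; have := w 0; rewrite eb -wordS alt.
by case: (word _ 0).
Qed.

End StdPrimitive.

Section Primitives.
Variables (k : closedFieldType) (p : nat).

Lemma stdM_primitive m a : p \in [pchar k]%R -> (2 : k)%R != 0%R -> a <= m ->
  exists B : monomial p (stdM k p m a), primitive B.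
Proof.
move=> chp two ham; have [h|] := boolP ((0 < m) ==> (a < m)).
  exists (std_monomial k p ham) => x n; apply: std_primitive_iter => //.
  by move/implyP: h.
rewrite negb_imply -leqNgt => /andP[m0 le].
have -> : a = m by apply/eqP; rewrite eqn_leq ham.
by exists (ord_monomial chp two m0); apply: ord_primitive.
Qed.

Variables (M N : gradedFV k) (A : monomial p M) (B : monomial p N).
Local Notation C := (dsum_monomial A B).

Lemma word_inl (x : idx A) :
  word (@be _ _ _ C) (@tau _ _ _ C) (inl x) =1 word (@be _ _ _ A) (@tau _ _ _ A) x.
Proof.
move=> t; rewrite /word.
suff -> : iter t.+1 (@be _ _ _ C) (inl x) = inl (iter t.+1 (@be _ _ _ A) x) by [].
by elim: t.+1 => //= n ->.
Qed.

Lemma word_inr (x : idx B) :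
  word (@be _ _ _ C) (@tau _ _ _ C) (inr x) =1 word (@be _ _ _ B) (@tau _ _ _ B) x.
Proof.
move=> t; rewrite /word.
suff -> : iter t.+1 (@be _ _ _ C) (inr x) = inr (iter t.+1 (@be _ _ _ B) x) by [].
by elim: t.+1 => //= n ->.
Qed.

Lemma dsum_primitive : primitive A -> primitive B -> primitive C.
Proof.
move=> pA pB [x|x] n.
  have -> : iter n (@pi _ _ _ C) (inl x) = inl (iter n (@pi _ _ _ A) x).
    by elim: n => //= n ->.
  by move=> w; congr inl; apply: pA => t; rewrite -!word_inl w.
have -> : iter n (@pi _ _ _ C) (inr x) = inr (iter n (@pi _ _ _ B) x).
  by elim: n => //= n ->.
by move=> w; congr inr; apply: pB => t; rewrite -!word_inr w.
Qed.

End Primitives.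

Lemma std_code_ss m a B s : 2 * a <= m ->
  std_code m a B s
    = if s <= a then s else if s <= m - a then B else B.*2 - (m - s).
Proof.
move=> ss; rewrite /std_code /upper ss.
have -> : minn a (m - a) = a by lia.
by case: ifP => // _; rewrite ltnNge; case: leqP.
Qed.

Lemma std_code_nonss m a B s : a <= m -> m < 2 * a ->
  std_code m a B s
    = if s <= m - a then s else if s < a then B else B.*2 - (m - s).
Proof.
move=> am ns; have ss : (2 * a <= m) = false by lia.
rewrite /std_code /upper ss; have -> : minn a (m - a) = m - a by lia.
by rewrite subKn //; case: ifP => // _; rewrite leqNgt; case: ltnP.
Qed.

(** * Comparison of words from two standard modules *)

Section WordComparison.
Variables (m a n b : nat) (ham : a <= m) (hbn : b <= n).

Lemma std_code_lexlt B s t : m < B -> n < B -> s <= m -> t <= n ->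
  std_code m a B s < std_code n b B t -> lexlt (wd m a s) (wd n b t).
Proof. by move=> mB nB sm tn; apply: code_lexlt; apply: wd_code. Qed.

(** Both words start with (VF)^s and continue as the words of index 0, which decide between equal
    codes. *)
Lemma lexlt_lower s : s <= minn a (m - a) -> s <= minn b (n - b) ->
  lexlt (wd m a 0) (wd n b 0) -> lexlt (wd m a s) (wd n b s).
Proof.
move=> sa sb lt; have [ra ea] := wd_lower ham sa; have [rb eb] := wd_lower hbn sb.
apply: (@lexlt_shift s.*2); first exact: vf_run_eq.
by apply: eq_lexlt lt => t; rewrite ?ea ?eb.
Qed.

(** Both words start with (VF)^i VV and continue as the words of the indices [a] and [b]. *)
Lemma lexlt_upper i : i <= m -> i <= n -> upper m a (m - i) -> upper n b (n - i) ->
  lexlt (wd m a a) (wd n b b) -> lexlt (wd m a (m - i)) (wd n b (n - i)).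
Proof.
move=> im jn ua ub lt.
have [ra ea] := wd_upper ham im ua; have [rb eb] := wd_upper hbn jn ub.
have [a0 a1 aS] := wd_top ham (upper_top ham (leq_subr _ _) ua).
have [b0 b1 bS] := wd_top hbn (upper_top hbn (leq_subr _ _) ub).
apply: (@lexlt_shift i.*2); first exact: vf_run_eq.
apply: (@lexlt_shift 2) => [[|[|//]] _|]; rewrite ?ea ?eb ?a0 ?a1 ?b0 ?b1 //.
by apply: eq_lexlt lt => t; rewrite ?ea ?eb ?add2n ?aS ?bS.
Qed.

(** For [b = 0] the second word starts with FV and the first with FF. Otherwise both start with FF,
    after which the second has [b - 1] rounds of VF and then VV, while the first has [a - 1] rounds
    and then VV, or ends its rounds with F. *)
Lemma lexlt_bottom : 0 < a -> 2 * b <= n -> (2 * a <= m -> b < a) ->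
  lexlt (wd m a 0) (wd n b 0).
Proof.
move=> a0 ssb ab.
have m1 : wd m a 0 1 = false by rewrite wd1 //; rewrite /back1 /=; lia.
have [b0|b0] := posnP b.
  exists 1; split=> // [[|//] _|]; first by rewrite !wd0.
  by rewrite wd1 // /back1 b0 /= subn0 eqxx.
have n1 : wd n b 0 1 = false by rewrite wd1 //; rewrite /back1 /=; lia.
apply: (@lexlt_shift 2) => [[|[|//]] _|]; rewrite ?m1 ?n1 ?wd0 //.
apply: (eq_lexlt (f := wd m a (back2 m a (back1 m a 0)))
                 (g := wd n b (back2 n b (back1 n b 0)))) => [t|t|].
- by rewrite add2n wdSS.
- by rewrite add2n wdSS.
apply: (@std_code_lexlt (m + n).+1); rewrite ?back2_le ?back1_le //; try lia.
rewrite [std_code n b _ _]std_code_ss //.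
have -> : back2 n b (back1 n b 0) = (n - b).+1.
  by rewrite /back1 /back2 /=; repeat case: ifP; lia.
have [ss|ns] := leqP (2 * a) m.
  have -> : back2 m a (back1 m a 0) = (m - a).+1.
    by rewrite /back1 /back2 /=; repeat case: ifP; lia.
  by rewrite std_code_ss //; repeat case: ifP; lia.
have -> : back2 m a (back1 m a 0) = m - a.
  by rewrite /back1 /back2 /=; repeat case: ifP; lia.
by rewrite std_code_nonss //; repeat case: ifP; lia.
Qed.

(** Two steps back run cyclically through the indices from [a] up to [m], and this cycle, measured
    by the distance from the top, depends only on [m - a]. *)
Lemma wd_eq_nonsupersingular : m - a = n - b -> m < 2 * a -> n < 2 * b ->
  wd m a a =1 wd n b b.
Proof.
move=> e sa sb.
(* Each step back by two consumes two letters, so the induction carries positions [t] and [t.+1]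
   together. *)
suff h t : (forall i, i <= m - a -> wd m a (m - i) t = wd n b (n - i) t) /\
           (forall i, i <= m - a -> wd m a (m - i) t.+1 = wd n b (n - i) t.+1).
  move=> t; have [/(_ (m - a) (leqnn _)) + _] := h t.
  by rewrite subKn // e subKn.
elim: t => [|t [IH0 IH1]]; split=> // i ie.
- by rewrite !wd0; lia.
- by rewrite !wd1 ?leq_subr //; rewrite /back1; repeat case: ifP; lia.
rewrite !wdSS ?leq_subr //; case: i ie => [|i] ie.
  have -> : back2 m a (back1 m a (m - 0)) = m - (m - a).
    by rewrite /back1 /back2; repeat case: ifP; lia.
  have -> : back2 n b (back1 n b (n - 0)) = n - (m - a).
    by rewrite /back1 /back2; repeat case: ifP; lia.
  exact: IH0.
have -> : back2 m a (back1 m a (m - i.+1)) = m - i.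
  by rewrite /back1 /back2; repeat case: ifP; lia.
have -> : back2 n b (back1 n b (n - i.+1)) = n - i.
  by rewrite /back1 /back2; repeat case: ifP; lia.
by apply: IH0; lia.
Qed.

End WordComparison.

(** Two steps back run through a, a-1, ..., 0, then m-a+1, ..., m, and return to a. Measured from
    the bottom in the first stretch and from the top in the second, this cycle depends only on
    [a]. *)
Lemma wd_eq_supersingular m n a : 2 * a <= m -> 2 * a <= n -> wd m a a =1 wd n a a.
Proof.
move=> sm sn; have am : a <= m by lia.
have an : a <= n by lia.
suff h t : ((forall s, s <= a -> wd m a s t = wd n a s t) /\
            (forall i, i < a -> wd m a (m - i) t = wd n a (n - i) t)) /\
           ((forall s, s <= a -> wd m a s t.+1 = wd n a s t.+1) /\
            (forall i, i < a -> wd m a (m - i) t.+1 = wd n a (n - i) t.+1)).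
  by move=> t; have [[/(_ a (leqnn _))]] := h t.
elim: t => [|t [[IH0 IH0'] IH1]]; split=> //; split=> i ia.
- by rewrite !wd0; lia.
- by rewrite !wd0; lia.
- by rewrite !wd1 //; try lia; rewrite /back1; repeat case: ifP; lia.
- by rewrite !wd1 //; try lia; rewrite /back1; repeat case: ifP; lia.
- rewrite !wdSS //; try lia; case: i ia => [|i] ia.
    case: (posnP a) => a0.
      by subst a; rewrite /back1 /back2 /= !subn0 !eqxx; exact: IH0.
    have -> : back2 m a (back1 m a 0) = m - a.-1.
      by rewrite /back1 /back2 /=; repeat case: ifP; lia.
    have -> : back2 n a (back1 n a 0) = n - a.-1.
      by rewrite /back1 /back2 /=; repeat case: ifP; lia.
    by apply: IH0'; lia.
  have -> : back2 m a (back1 m a i.+1) = i.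
    by rewrite /back1 /back2; repeat case: ifP; lia.
  have -> : back2 n a (back1 n a i.+1) = i.
    by rewrite /back1 /back2; repeat case: ifP; lia.
  by apply: IH0; lia.
rewrite !wdSS //; try lia; case: i ia => [|i] ia.
  have -> : back2 m a (back1 m a (m - 0)) = a.
    by rewrite /back1 /back2; repeat case: ifP; lia.
  have -> : back2 n a (back1 n a (n - 0)) = a.
    by rewrite /back1 /back2; repeat case: ifP; lia.
  exact: IH0.
have -> : back2 m a (back1 m a (m - i.+1)) = m - i.
  by rewrite /back1 /back2; repeat case: ifP; lia.
have -> : back2 n a (back1 n a (n - i.+1)) = n - i.
  by rewrite /back1 /back2; repeat case: ifP; lia.
by apply: IH0'; lia.
Qed.

(** * The Ekedahl-Oort index *)

Section Graded.
Variables (k : closedFieldType) (p : nat) (p_gt0 : 0 < p).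

Lemma bspan_graded_dieudonne (L : gradedFV k) (B : monomial p L) (S : {set idx B}) :
  dieudonne p L -> gr1 L = bspan (B := B) S -> gr2 L = bspan (B := B) (~: S) ->
  (forall x, (pi x \in S) = (x \notin S)) -> graded_dieudonne p L.
Proof.
move=> dL e1 e2 flip; split=> //.
- rewrite e1 e2 bspan_capI setICr bspan_set0; split=> //.
  apply/vspaceP => z; rewrite memvf {1}(coordE B z); apply: memv_suml => x _.
  apply: memvZ; have [xS|xS] := boolP (x \in S).
    by apply: (subvP (addvSl _ _)); rewrite memvE; exact: (sumv_sup x).
  by apply: (subvP (addvSr _ _)); rewrite memvE; apply: (sumv_sup x); rewrite ?inE.
- move=> z; rewrite e1 e2 => /mem_bspan h; split; apply/mem_bspan => x.
    rewrite inE negbK -{1}(beK x) flip => nx; rewrite -(beK x) coord_Fr h // frob0 //.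
    by rewrite mul0r if_same.
  rewrite inE negbK => xS; rewrite coord_Ve h ?flip ?negbK // frobV0 //.
  by rewrite mul0r if_same.
move=> z; rewrite e1 e2 => /mem_bspan h; split; apply/mem_bspan => x.
  rewrite -{1}(beK x) flip => nx; rewrite -(beK x) coord_Fr h ?inE // frob0 //.
  by rewrite mul0r if_same.
move=> xS; rewrite coord_Ve h ?inE ?flip ?xS // frobV0 //.
by rewrite mul0r if_same.
Qed.

Lemma subspace_sum_bspan (M N : gradedFV k) (A : monomial p M) (B : monomial p N)
    (S : {set idx A}) (T : {set idx B}) :
  subspace_sum (bspan S) (bspan T)
    = bspan (B := dsum_monomial A B)
        [set x | match x with inl y => y \in S | inr y => y \in T end].
Proof.
apply: (eq_bspan (B := dsum_monomial A B)) => z; rewrite mem_subspace_sum; split.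
  by move=> /andP[/mem_bspan hS /mem_bspan hT] [x|x]; rewrite inE; [exact: hS|exact: hT].
move=> h; apply/andP; split; apply/mem_bspan => x nx.
  by apply: (h (inl x)); rewrite inE.
by apply: (h (inr x)); rewrite inE.
Qed.

End Graded.

(** This computes ranks: in each summand, the degree-1 vectors that precede a killed vector form a
    prefix of the index order. *)
Lemma card_sum_ord_prefix (m n c d : nat) (P : pred ('I_2 * 'I_m.+1 + 'I_2 * 'I_n.+1)) :
  c <= m.+1 -> d <= n.+1 ->
  (forall s, s <= m -> P (inl (pt m 0%R s)) = (s < c)) ->
  (forall s, s <= n -> P (inr (pt n 0%R s)) = (s < d)) ->
  #|[set x | match x with inl y => y.1 == 0%R | inr y => y.1 == 0%R end & P x]| = c + d.
Proof.
move=> cm dn hc hd.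
have pre l e (Q : pred 'I_l.+1) : e <= l.+1 -> (forall s : 'I_l.+1, Q s = (s < e)) ->
    \sum_(s | Q s) 1 = e.
  move=> le h; rewrite (eq_bigl (fun s : 'I_l.+1 => s < e)) //.
  by rewrite -(big_ord_widen l.+1 (fun=> 1) le) sum1_card card_ord.
have line l e (Q : pred ('I_2 * 'I_l.+1)) : e <= l.+1 ->
    (forall s, s <= l -> Q (pt l 0%R s) = (s < e)) ->
    \sum_(x | (x.1 == 0%R) && Q x) 1 = e.
  move=> le h; rewrite -[RHS](pre l e (fun s => Q (0%R, s))) // => [|s]; last first.
    by rewrite -h -1?ltnS // /pt inord_val.
  rewrite (reindex_onto (fun s : 'I_l.+1 => (0%R, s)) snd) /=; last first.
    by case=> g s /= /andP[/eqP -> _].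
  by apply: eq_bigl => s; rewrite !eqxx andbT.
rewrite -sum1_card big_sumType /=; congr (_ + _).
  by rewrite -(line m c (fun x => P (inl x))) //; apply: eq_bigl => x; rewrite inE.
by rewrite -(line n d (fun x => P (inr x))) //; apply: eq_bigl => x; rewrite inE.
Qed.

(** * The two ranks in the direct sum of two standard modules *)

Section Main.
Variables (k : closedFieldType) (p : nat) (chp : p \in [pchar k]%R).
Variables (m n a b : nat) (ham : a <= m) (hbn : b <= n).

Let L := dsum (stdM k p m a) (stdM k p n b).
Let C : monomial p L := dsum_monomial (std_monomial k p ham) (std_monomial k p hbn).
Let p_gt0 : 0 < p := pchar_gt0 chp.

Let gr : {set idx C} :=
  [set x | match x with inl y => y.1 == 0%R | inr y => y.1 == 0%R end].

Let it : idx C -> nat := itinerary (@tau _ _ _ C) (@beK _ _ _ C).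
Let eM s : idx C := inl (pt m 0%R s).
Let eN s : idx C := inr (pt n 0%R s).

Let gr1E : gr1 L = bspan (B := C) gr.
Proof.
transitivity (subspace_sum (bspan (B := std_monomial k p ham) [set x | x.1 == 0%R])
                           (bspan (B := std_monomial k p hbn) [set x | x.1 == 0%R])).
  by congr subspace_sum; rewrite -std_gr.
rewrite subspace_sum_bspan.
by congr bspan; apply/setP => -[x|x]; rewrite !inE.
Qed.

Let gr2E : gr2 L = bspan (B := C) (~: gr).
Proof.
transitivity (subspace_sum (bspan (B := std_monomial k p ham) [set x | x.1 == 1%R])
                           (bspan (B := std_monomial k p hbn) [set x | x.1 == 1%R])).
  by congr subspace_sum; rewrite -std_gr.
rewrite subspace_sum_bspan.
by congr bspan; apply/setP => -[[g s]|[g s]]; rewrite !inE /=; case: (ord2P g) => ->.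
Qed.

Let pi_gr x : (pi x \in gr) = (x \notin gr).
Proof. by case: x => -[g s]; rewrite !inE /=; case: (ord2P g) => ->. Qed.

Let L_dieudonne : dieudonne p L.
Proof. by apply: dsum_dieudonne; apply: stdM_dieudonne. Qed.

Lemma dsum_std_graded : graded_dieudonne p L.
Proof. exact: bspan_graded_dieudonne L_dieudonne gr1E gr2E pi_gr. Qed.

Let card_gr : #|gr| = (m + n).+2.
Proof.
rewrite -[RHS](_ : m.+1 + n.+1 = _); last by lia.
rewrite -(@card_sum_ord_prefix m n m.+1 n.+1 xpredT) //.
by congr #|pred_of_set _|; apply/setP => x; rewrite !inE andbT.
Qed.

Lemma dim_gr1 : \dim (gr1 L) = m + n + 2.
Proof. by rewrite gr1E dim_bspan card_gr addn2. Qed.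

Let ker_gr : [set x in gr | ~~ @tau _ _ _ C x] = [set eM a; eN b].
Proof.
apply/setP => -[[g s]|[g s]]; rewrite !inE /= /std_tau /=.
  rewrite orbF; case: (ord2P g) => -> /=; last by [].
  rewrite negbK; apply/eqP/eqP => [e|[->]]; last by rewrite inordK.
  by congr (inl (_, _)); apply: val_inj; rewrite /= inordK.
case: (ord2P g) => -> /=; last by [].
rewrite negbK; apply/eqP/eqP => [e|[->]]; last by rewrite inordK.
by congr (inr (_, _)); apply: val_inj; rewrite /= inordK.
Qed.

Lemma dim_gr1_ker : \dim (gr1 L :&: semiker (@Fr k L))%VS = 2.
Proof.
have [LF _] := L_dieudonne.
rewrite gr1E (semiker_bspan p_gt0 C LF) bspan_capI dim_bspan.
rewrite (_ : _ :&: _ = [set eM a; eN b]) ?cards2 // -ker_gr.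
by apply/setP => x; rewrite !inE.
Qed.

(** Strict comparison with a successor here and weak comparison in [upper_jump] make the two jumps
    consecutive when the killed vectors are tied. *)
Definition lower_jump : nat :=
  #|[set x in gr | it x < minn (it (eM a)) (it (eN b))]|.+1.

Definition upper_jump : nat :=
  #|[set x in gr | it x <= maxn (it (eM a)) (it (eN b))]|.

Lemma dsum_std_EO_index : (2 : k)%R != 0%R -> in_Wc2 (gamma (m + n) lower_jump upper_jump) /\
  EO_index L (gamma (m + n) lower_jump upper_jump).
Proof.
move=> two_neq0.
have [LF _] := L_dieudonne.
have jumps (W : 'I_(\dim {:L}).+1 -> {vspace L}) : final_filtration W ->
    eta1_jumps (m + n) W lower_jump upper_jump.
  move=> Wf; have nMN : eM a != eN b by [].
  rewrite /lower_jump /upper_jump; case: (leqP (it (eM a)) (it (eN b))) => le.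
    exact: (eta1_jumps_itin p_gt0 LF gr1E Wf card_gr nMN ker_gr le).
  apply: (eta1_jumps_itin p_gt0 LF gr1E Wf card_gr _ _ (ltnW le)); first by [].
  by rewrite ker_gr setUC.
have exW : exists W : 'I_(\dim {:L}).+1 -> {vspace L}, final_filtration W.
  (* Existence is obtained from primitive bases, repaired where necessary; the jumps above are read
     off the given basis. *)
  have [A pA] := stdM_primitive chp two_neq0 ham.
  have [B pB] := stdM_primitive chp two_neq0 hbn.
  exact: (final_filtration_exists p_gt0 (dsum_primitive pA pB)).
split; last first.
  by split=> // W /jumps h; exists lower_jump, upper_jump.
have [W /jumps [u1 uv vc _]] := exW.
by exists lower_jump, upper_jump.
Qed.

Let lexMM s t : lexlt (wd m a s) (wd m a t) -> it (eM s) < it (eM t).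
Proof.
move=> lt; apply: (itin_lex (@piK _ _ _ C)).
by apply: eq_lexlt lt => i; rewrite word_inl.
Qed.

Let lexMN s t : lexlt (wd m a s) (wd n b t) -> it (eM s) < it (eN t).
Proof.
move=> lt; apply: (itin_lex (@piK _ _ _ C)).
by apply: eq_lexlt lt => i; rewrite ?word_inl ?word_inr.
Qed.

Let lexNM s t : lexlt (wd n b s) (wd m a t) -> it (eN s) < it (eM t).
Proof.
move=> lt; apply: (itin_lex (@piK _ _ _ C)).
by apply: eq_lexlt lt => i; rewrite ?word_inl ?word_inr.
Qed.

Let lexNN s t : lexlt (wd n b s) (wd n b t) -> it (eN s) < it (eN t).
Proof.
move=> lt; apply: (itin_lex (@piK _ _ _ C)).
by apply: eq_lexlt lt => i; rewrite word_inr.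
Qed.

Let eqMN s t : wd m a s =1 wd n b t -> it (eM s) = it (eN t).
Proof. by move=> e; apply: eq_wval => i; rewrite word_inl word_inr; exact: e. Qed.

Let cM s := std_code m a (m + n).+1 s.
Let cN s := std_code n b (m + n).+1 s.

Let codeMM s t : s <= m -> t <= m -> cM s < cM t -> it (eM s) < it (eM t).
Proof. by move=> sm tm lt; apply: lexMM; apply: (std_code_lexlt ham ham _ _ sm tm lt); lia. Qed.

Let codeMN s t : s <= m -> t <= n -> cM s < cN t -> it (eM s) < it (eN t).
Proof. by move=> sm tm lt; apply: lexMN; apply: (std_code_lexlt ham hbn _ _ sm tm lt); lia. Qed.

Let codeNM s t : s <= n -> t <= m -> cN s < cM t -> it (eN s) < it (eM t).
Proof. by move=> sm tm lt; apply: lexNM; apply: (std_code_lexlt hbn ham _ _ sm tm lt); lia. Qed.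

Let codeNN s t : s <= n -> t <= n -> cN s < cN t -> it (eN s) < it (eN t).
Proof. by move=> sm tm lt; apply: lexNN; apply: (std_code_lexlt hbn hbn _ _ sm tm lt); lia. Qed.

(** Index [a] is either the last lower index or the first upper one, never neutral, so its code
    differs from all others. *)
Let selfMM s : s <= m ->
  ((s < a) -> it (eM s) < it (eM a)) /\ ((a < s) -> it (eM a) < it (eM s)).
Proof.
move=> sm; split=> lt; apply: codeMM => //;
  by rewrite /cM /std_code /upper; repeat case: ifP; lia.
Qed.

Let selfNN s : s <= n ->
  ((s < b) -> it (eN s) < it (eN b)) /\ ((b < s) -> it (eN b) < it (eN s)).
Proof.
move=> sm; split=> lt; apply: codeNN => //;
  by rewrite /cN /std_code /upper; repeat case: ifP; lia.
Qed.

Let ltM s : s <= m -> (it (eM s) < it (eM a)) = (s < a).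
Proof.
move=> /selfMM[]; case: (ltngtP s a) => [lt|gt|->] h1 h2; last exact: ltnn.
  by rewrite h1.
by apply/negbTE; rewrite -leqNgt ltnW // h2.
Qed.

Let leM s : s <= m -> (it (eM s) <= it (eM a)) = (s <= a).
Proof.
move=> /selfMM[]; case: (ltngtP s a) => [lt|gt|->] h1 h2; last exact: leqnn.
  by rewrite ltnW // h1.
by apply/negbTE; rewrite -ltnNge h2.
Qed.

Let ltN s : s <= n -> (it (eN s) < it (eN b)) = (s < b).
Proof.
move=> /selfNN[]; case: (ltngtP s b) => [lt|gt|->] h1 h2; last exact: ltnn.
  by rewrite h1.
by apply/negbTE; rewrite -leqNgt ltnW // h2.
Qed.

Let leN s : s <= n -> (it (eN s) <= it (eN b)) = (s <= b).
Proof.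
move=> /selfNN[]; case: (ltngtP s b) => [lt|gt|->] h1 h2; last exact: leqnn.
  by rewrite ltnW // h1.
by apply/negbTE; rewrite -ltnNge h2.
Qed.

Let card_gr_prefix c d (P : pred (idx C)) : c <= m.+1 -> d <= n.+1 ->
  (forall s, s <= m -> P (eM s) = (s < c)) ->
  (forall s, s <= n -> P (eN s) = (s < d)) -> #|[set x in gr | P x]| = c + d.
Proof.
move=> cm dn hc hd; rewrite -(@card_sum_ord_prefix m n c d P) //.
by congr #|pred_of_set _|; apply/setP => x; rewrite !inE.
Qed.

Let jumps_tie : it (eM a) = it (eN b) ->
  lower_jump = (a + b).+1 /\ upper_jump = (a + b).+2.
Proof.
move=> e; rewrite /lower_jump /upper_jump e minnn maxnn; split.
  congr S; apply: card_gr_prefix; rewrite -1?e; try lia; [exact: ltM|].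
  by move=> s; rewrite e; exact: ltN.
rewrite (_ : (a + b).+2 = a.+1 + b.+1); last by lia.
apply: card_gr_prefix; rewrite -1?e; try lia; [exact: leM|].
by move=> s; rewrite e; exact: leN.
Qed.

(** Here [c] counts the degree-1 vectors of [M] before e_{1,b+1} of [N], and [d] those of [N] before
    e_{1,a+1} of [M]. In its own module the rank of each killed vector is given by its index. *)
Let jumps_strict c d : it (eN b) < it (eM a) -> c <= m.+1 -> d <= n.+1 ->
  (forall s, s <= m -> if s < c then it (eM s) < it (eN b) else it (eN b) < it (eM s)) ->
  (forall s, s <= n -> if s < d then it (eN s) < it (eM a) else it (eM a) < it (eN s)) ->
  lower_jump = (c + b).+1 /\ upper_jump = (a + d).+1.
Proof.
move=> lt cm dn hM hN; rewrite /lower_jump /upper_jump (minn_idPr (ltnW lt)).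
rewrite (maxn_idPl (ltnW lt)); split.
  congr S; apply: card_gr_prefix; [lia|lia| |exact: ltN] => s /hM.
  case: ifP => _ h; first by rewrite h.
  by apply/negbTE; rewrite -leqNgt ltnW.
rewrite (_ : (a + d).+1 = a.+1 + d) //.
apply: card_gr_prefix; [lia|lia|exact: leM|] => s /hN.
case: ifP => _ h; first by rewrite ltnW.
by apply/negbTE; rewrite -ltnNge.
Qed.

Lemma jumps_A_eq : 2 * a <= m -> 2 * b <= n -> a = b ->
  lower_jump = 2 * b + 1 /\ upper_jump = 2 * b + 2.
Proof.
move=> sa sb e.
have eqw : wd m a a =1 wd n b b by rewrite -e; apply: wd_eq_supersingular; lia.
by have [-> ->] := jumps_tie (eqMN eqw); lia.
Qed.

Lemma jumps_A_lt : 2 * a <= m -> 2 * b <= n -> b < a ->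
  lower_jump = 2 * b + 2 /\ upper_jump = a + b + 2.
Proof.
move=> sa sb ba; have [|||s sm|s sn|-> ->] := @jumps_strict b.+1 b.+1; try lia.
- by apply: codeNM => //; rewrite /cM /cN !std_code_ss //; repeat case: ifP; lia.
- case: ifP => h.
    (* At [s = b] the codes agree, and the words of index 0 break the tie in favour of [M]. *)
    have [->|sb'] := eqVneq s b.
      by apply: lexMN; apply: lexlt_lower; rewrite //; try lia; apply: lexlt_bottom => //; lia.
    by apply: codeMN => //; rewrite /cM /cN !std_code_ss //; repeat case: ifP; lia.
  by apply: codeNM => //; rewrite /cM /cN !std_code_ss //; repeat case: ifP; lia.
case: ifP => h.
  by apply: codeNM => //; rewrite /cM /cN !std_code_ss //; repeat case: ifP; lia.
by apply: codeMN => //; rewrite /cM /cN !std_code_ss //; repeat case: ifP; lia.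
Qed.

Lemma jumps_B : m < 2 * a -> n < 2 * b -> m - a <= n - b ->
  lower_jump = a + b + 1 /\ upper_jump = 2 * a + n - m + 2.
Proof.
move=> sa sb; rewrite leq_eqVlt => /orP[/eqP e|lt].
  by have [-> ->] := jumps_tie (eqMN (wd_eq_nonsupersingular ham hbn e sa sb)); lia.
have lex : lexlt (wd n b b) (wd m a a).
  apply: (@std_code_lexlt _ _ _ _ _ _ (m + n).+1); rewrite //; try lia.
  by rewrite !std_code_nonss //; repeat case: ifP; lia.
(* Before e_{1,b+1} of [N] come exactly the lower and neutral indices of [M]; before e_{1,a+1} of
   [M] come the indices [s] of [N] at distance at least [m - a] from the top. *)
have [|||s sm|s sn|-> ->] := @jumps_strict a (n - (m - a)).+1; try lia.
- exact: lexNM.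
- case: ifP => h.
    by apply: codeMN => //; rewrite /cM /cN !std_code_nonss //; repeat case: ifP; lia.
  by apply: codeNM => //; rewrite /cM /cN !std_code_nonss //; repeat case: ifP; lia.
case: ifP => h.
  have [e|ne] := eqVneq s (n - (m - a)).
    rewrite e; apply: lexNM; have := @lexlt_upper n b m a hbn ham (m - a).
    by rewrite subKn //; apply=> //; try lia; rewrite /upper; repeat case: ifP; lia.
  by apply: codeNM => //; rewrite /cM /cN !std_code_nonss //; repeat case: ifP; lia.
by apply: codeMN => //; rewrite /cM /cN !std_code_nonss //; repeat case: ifP; lia.
Qed.

Lemma jumps_C : m < 2 * a -> 2 * b <= n ->
  lower_jump = b + 2 + minn b (m - a) /\
  upper_jump = a + 2 + maxn (n + a - m) (n - b).
Proof.
move=> sa sb.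
have lex : lexlt (wd n b b) (wd m a a).
  apply: (@std_code_lexlt _ _ _ _ _ _ (m + n).+1); rewrite //; try lia.
  by rewrite [std_code m _ _ _]std_code_nonss ?std_code_ss //; repeat case: ifP; lia.
(* Before e_{1,b+1} of [N] come the lower indices of [M] up to [b]; before e_{1,a+1} of [M] come all
   indices of [N] but the upper ones at distance less than [m - a] from the top. *)
have [|||s sm|s sn|-> ->] := @jumps_strict (minn b (m - a)).+1 (n - minn b (m - a)).+1;
  try lia.
- exact: lexNM.
- case: ifP => h.
    have [e|ne] := eqVneq s b.
      rewrite e; apply: lexMN; apply: lexlt_lower; rewrite //; try lia.
      by apply: lexlt_bottom => //; lia.
    by apply: codeMN => //; rewrite /cM /cN [std_code m _ _ _]std_code_nonss ?std_code_ss //; repeat case: ifP; lia.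
  by apply: codeNM => //; rewrite /cM /cN [std_code m _ _ _]std_code_nonss ?std_code_ss //; repeat case: ifP; lia.
case: ifP => h.
  (* The codes agree only at the upper index of [N] at distance [m - a] from the top, which exists
     when [m - a < b]. *)
  have [[e lt]|ne] : (s = n - (m - a) /\ m - a < b) \/ ~ (s = n - (m - a) /\ m - a < b).
  - by lia.
  - rewrite e; apply: lexNM; have := @lexlt_upper n b m a hbn ham (m - a).
    by rewrite subKn //; apply=> //; try lia; rewrite /upper; repeat case: ifP; lia.
  by apply: codeNM => //; rewrite /cM /cN [std_code m _ _ _]std_code_nonss ?std_code_ss //; repeat case: ifP; lia.
by apply: codeMN => //; rewrite /cM /cN [std_code m _ _ _]std_code_nonss ?std_code_ss //; repeat case: ifP; lia.
Qed.

End Main.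

Local Open Scope ring_scope.

Theorem theorem4p10 (p : nat) (k : closedFieldType)
    (iota : {rmorphism 'F_p -> k}) (m n a b : nat)
    (p_prime : prime p) (p_gt2 : (2 < p)%N)
    (k_alg : forall x : k, algebraicOver iota x)
    (ham : (a <= m)%N) (hbn : (b <= n)%N) :
  let L := dsum (stdM k p m a) (stdM k p n b) in
  [/\ graded_dieudonne p L,
      \dim (gr1 L) = (m + n + 2)%N,
      \dim (gr1 L :&: semiker (@Fr k L))%VS = 2%N
    & exists g : 'S_(m + n).+2,
      [/\ in_Wc2 g /\ EO_index L g,
          supersingular m a -> supersingular n b -> (b <= a)%N ->
            (a = b -> g = gamma (m + n) (2 * b + 1) (2 * b + 2)) /\
            ((b < a)%N -> g = gamma (m + n) (2 * b + 2) (a + b + 2)),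
          ~~ supersingular m a -> ~~ supersingular n b ->
            (m - a <= n - b)%N ->
            g = gamma (m + n) (a + b + 1) (2 * a + n - m + 2)
        & (* if n + a < m the truncated difference is 0, which leaves the
             maximum with n - b >= 0 unchanged *)
          ~~ supersingular m a -> supersingular n b ->
            g = gamma (m + n) (b + 2 + minn b (m - a))
                              (a + 2 + maxn (n + a - m) (n - b))]].
Proof.
have chp : p \in [pchar k] by rewrite (fmorph_pchar iota) pchar_Fp.
have two : (2 : k) != 0.
  by rewrite -(dvdn_pcharf chp) gtnNdvd.
move=> L; split.
- exact (dsum_std_graded chp ham hbn).
- exact (dim_gr1 chp ham hbn).
- exact (dim_gr1_ker chp ham hbn).
exists (gamma (m + n) (lower_jump k p ham hbn) (upper_jump k p ham hbn)).
have [gW EO] := dsum_std_EO_index chp ham hbn two.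
rewrite /supersingular; split=> //.
- move=> sa sb _; split=> h.
    by have [-> ->] := jumps_A_eq chp ham hbn sa sb h.
  by have [-> ->] := jumps_A_lt chp ham hbn sa sb h.
- rewrite -!ltnNge => sa sb le.
  by have [-> ->] := jumps_B chp ham hbn sa sb le.
rewrite -ltnNge => sa sb.
by have [-> ->] := jumps_C chp ham hbn sa sb.
Qed.
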